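(* The following $\mathscr H_n^\Lambda$-module homomorphisms exist and are non-zero. 1. If $n\equiv\kappa_2-\kappa_1+1\pmod e$ and $0\leqslant m\leqslant n-1$, there is a non-zero homomorphism $$\gamma_m:S_{((n-m),(1^m))}\to S_{((n-m-1),(1^{m+1}))},\quad \gamma_m(z_{((n-m),(1^m))})=v(1,\dots,m,n).$$ 2. If $\kappa_2\equiv\kappa_1-1\pmod e$, there are non-zero homomorphisms: (a) for $1\leqslant m\leqslant n-1$, $\chi_m:S_{((n-m,1^m),\varnothing)}\to S_{((n-m),(1^m))}$ with $\chi_m(z_{((n-m,1^m),\varnothing)})=v(2,3,\dots,m+1)$; (b) for $1\leqslant m\leqslant n$, $\tau_m:S_{((n-m),(1^m))}\to S_{(\varnothing,(n-m+1,1^{m-1}))}$ with $\tau_m(z_{((n-m),(1^m))})=z_{(\varnothing,(n-m+1,1^{m-1}))}$. 3. If $\kappa_2\equiv\kappa_1-1\pmod e$ and $n\equiv 0\pmod e$, there are non-zero homomorphisms: (a) for $0\leqslant m\leqslant n-2$, $\alpha_m:S_{((n-m,1^m),\varnothing)}\to S_{((n-m-1,1^{m+1}),\varnothing)}$ with $\alpha_m(z_{((n-m,1^m),\varnothing)})=v(2,\dots,m+1,n)$; (b) for $0\leqslant m\leqslant n-2$, $\beta_m:S_{(\varnothing,(n-m,1^m))}\to S_{(\varnothing,(n-m-1,1^{m+1}))}$ with $\beta_m(z_{(\varnothing,(n-m,1^m))})=v(2,\dots,m+1,n)$; (c) for $1\leqslant m\leqslant n-1$, $\phi_m:S_{((n-m+1,1^{m-1}),\varnothing)}\to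 S_{((n-m),(1^m))}$ with $\phi_m(z_{((n-m+1,1^{m-1}),\varnothing)})=v(2,\dots,m,n)$. (In each case the vector $v(\dots)$ lies in the codomain.)
   Context: Let $\mathbb F$ be a field, $e\geqslant 3$ an integer, $I=\mathbb Z/e\mathbb Z$, $n\geqslant 1$ an integer and $\kappa=(\kappa_1,\kappa_2)\in I^2$. For $i,j\in I$ write $i\to j$ if $j=i+1$ and $i\leftarrow j$ if $j=i-1$. The symmetric group $\mathfrak S_n$, with $s_r=(r,r+1)$, acts on $I^n$ by place permutations. Algebra. $\mathscr H_n$ is the unital associative $\mathbb F$-algebra with generators $e(\mathbf i)$ ($\mathbf i\in I^n$), $y_1,\dots,y_n$, $\psi_1,\dots,\psi_{n-1}$ and relations: $e(\mathbf i)e(\mathbf j)=\delta_{\mathbf i,\mathbf j}e(\mathbf i)$; $\sum_{\mathbf i}e(\mathbf i)=1$; $y_re(\mathbf i)=e(\mathbf i)y_r$; $\psi_re(\mathbf i)=e(s_r\mathbf i)\psi_r$; $y_ry_s=y_sy_r$; $\psi_ry_s=y_s\psi_r$ if $s\ne r,r+1$; $\psi_r\psi_s=\psi_s\psi_r$ if $|r-s|>1$; $\psi_ry_{r+1}e(\mathbf i)=(y_r\psi_r+\delta_{i_r,i_{r+1}})e(\mathbf i)$; $y_{r+1}\psi_re(\mathbf i)=(\psi_ry_r+\delta_{i_r,i_{r+1}})e(\mathbf i)$; $\psi_r^2e(\mathbf i)$ equals $0$ if $i_r=i_{r+1}$, $(y_{r+1}-y_r)e(\mathbf i)$ if $i_r\to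 i_{r+1}$, $(y_r-y_{r+1})e(\mathbf i)$ if $i_r\leftarrow i_{r+1}$, and $e(\mathbf i)$ otherwise; $\psi_r\psi_{r+1}\psi_re(\mathbf i)$ equals $(\psi_{r+1}\psi_r\psi_{r+1}+1)e(\mathbf i)$ if $i_{r+2}=i_r\to i_{r+1}$, $(\psi_{r+1}\psi_r\psi_{r+1}-1)e(\mathbf i)$ if $i_{r+2}=i_r\leftarrow i_{r+1}$, and $\psi_{r+1}\psi_r\psi_{r+1}e(\mathbf i)$ otherwise. The cyclotomic algebra $\mathscr H_n^\Lambda$ (level 2) is the quotient of $\mathscr H_n$ by the relations $y_1^{c(i_1)}e(\mathbf i)=0$ for all $\mathbf i\in I^n$, where $c(i)=\#\{j\in\{1,2\}:\kappa_j=i\}$. Specht modules labelled by hook bipartitions. For $0\leqslant m\leqslant n$ put $\mathbf i_{((n-m),(1^m))}=(\kappa_2,\kappa_2-1,\dots,\kappa_2-m+1,\kappa_1,\kappa_1+1,\dots,\kappa_1+n-m-1)\in I^n$. $S_{((n-m),(1^m))}$ is the module generated by $z=z_{((n-m),(1^m))}$ subject only to $e(\mathbf i_{((n-m),(1^m))})z=z$, $y_rz=0$ for $1\leqslant r\leqslant n$, and $\psi_rz=0$ for all $r\in\{1,\dots,n-1\}\setminus\{m\}$; it is an $\mathscr H_n^\Lambda$-module. For $1\leqslant a_1<\dots<a_m\leqslant n$ define $v(a_1,\dots,a_m)=(\psi_{a_1-1}\cdots\psi_1)(\psi_{a_2-1}\cdots\psi_2)\cdots(\psi_{a_m-1}\cdots\psi_m)z$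 (indices decreasing in each factor; the factor is $1$ if $a_j=j$). These form an $\mathbb F$-basis (standard basis) of $S_{((n-m),(1^m))}$. Specht modules labelled by hooks in one component. For $0\leqslant m\leqslant n-1$ and $k\in\{1,2\}$ put $\mathbf j_k=(\kappa_k,\kappa_k-1,\dots,\kappa_k-m,\kappa_k+1,\kappa_k+2,\dots,\kappa_k+n-m-1)\in I^n$. $S_{((n-m,1^m),\varnothing)}$ (case $k=1$) and $S_{(\varnothing,(n-m,1^m))}$ (case $k=2$) are the modules generated by $z$ (written $z_{((n-m,1^m),\varnothing)}$, resp. $z_{(\varnothing,(n-m,1^m))}$) subject only to $e(\mathbf j_k)z=z$, $y_rz=0$ for $1\leqslant r\leqslant n$, $\psi_rz=0$ for $r\in\{1,\dots,n-1\}\setminus\{m+1\}$, and, if $m\leqslant n-2$, $\psi_1\psi_2\cdots\psi_{m+1}z=0$; they are $\mathscr H_n^\Lambda$-modules. For $2\leqslant b_2<\dots<b_{m+1}\leqslant n$ define in either module $v(b_2,\dots,b_{m+1})=(\psi_{b_2-1}\cdots\psi_2)(\psi_{b_3-1}\cdots\psi_3)\cdots(\psi_{b_{m+1}-1}\cdots\psi_{m+1})z$ (indices decreasing in each factor; the factor is $1$ if $b_j=j$); these form an $\mathbb F$-basis. *)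

(* Defs.v *)
From HB Require Import structures.
From mathcomp Require Import all_boot all_algebra.
From mathcomp Require Import generic_quotient ring_quotient boolp.
From mathcomp.multinomials Require Import monalg.

Set Implicit Arguments.
Unset Strict Implicit.
Unset Printing Implicit Defensive.

Import GRing.Theory.
Local Open Scope ring_scope.
Local Open Scope quotient_scope.

(* Quotients by relations.  A relation [X : A -> A -> Prop] is read as the set
   of equations [x = y] for [X x y].  Quotients may be zero, so they are
   [pzRingType]s rather than [nzRingType]s. *)
Section TwoSidedQuotient.
Variables (A : pzRingType) (X : A -> A -> Prop).

Inductive ideal_of : A -> Prop :=
| ideal_of_rel a x y b : X x y -> ideal_of (a * (x - y) * b)
| ideal_of0 : ideal_of 0
| ideal_ofD u v : ideal_of u -> ideal_of v -> ideal_of (u + v).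

Lemma ideal_ofM a u b : ideal_of u -> ideal_of (a * u * b).
Proof.
elim=> [c x y d Xxy||v w _ IHv _ IHw].
- have -> : a * (c * (x - y) * d) * b = a * c * (x - y) * (d * b) by rewrite !mulrA.
  exact: ideal_of_rel.
- by rewrite mulr0 mul0r; exact: ideal_of0.
- by rewrite mulrDr mulrDl; exact: ideal_ofD.
Qed.

Definition in_ideal : {pred A} := [pred u | `[< ideal_of u >]].

Lemma in_ideal_closed : zmod_closed in_ideal.
Proof.
split=> [|u v /asboolP Iu /asboolP Iv]; apply/asboolP; first exact: ideal_of0.
apply: ideal_ofD => //; have := ideal_ofM (-1) 1 Iv.
by rewrite mulr1 mulN1r.
Qed.
HB.instance Definition _ := GRing.isZmodClosed.Build A in_ideal in_ideal_closed.

Definition quot_ring : Type := {ideal_quot in_ideal}.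
HB.instance Definition _ := GRing.Zmodule.on quot_ring.

Definition quot_pi (a : A) : quot_ring := \pi_{ideal_quot in_ideal} a.
Definition quot_repr (u : quot_ring) : A := repr (u : {ideal_quot in_ideal}).

Lemma quot_reprK : cancel quot_repr quot_pi.
Proof. exact: reprK. Qed.

Lemma quot_piP a b : quot_pi a = quot_pi b <-> ideal_of (a - b).
Proof.
split=> [/eqP|Iab]; last apply/eqP.
  by rewrite -[_ == _]Quotient.idealrBE => /asboolP.
by rewrite -[_ == _]Quotient.idealrBE; apply/asboolP.
Qed.

Lemma quot_piB : {morph quot_pi : a b / a - b}.
Proof. by move=> a b; rewrite /quot_pi raddfB. Qed.

Definition quot_mul (u v : quot_ring) := quot_pi (quot_repr u * quot_repr v).

Lemma quot_piM : {morph quot_pi : a b / a * b >-> quot_mul a b}.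
Proof.
move=> a b; apply/quot_piP.
have Ir c : ideal_of (c - quot_repr (quot_pi c)).
  by apply/quot_piP; rewrite quot_reprK.
have -> : a * b - quot_repr (quot_pi a) * quot_repr (quot_pi b) =
    1 * (a - quot_repr (quot_pi a)) * b
    + quot_repr (quot_pi a) * (b - quot_repr (quot_pi b)) * 1.
  by rewrite mul1r mulr1 mulrBl mulrBr addrA subrK.
by apply: ideal_ofD; exact: ideal_ofM.
Qed.

Fact quot_piD : {morph quot_pi : a b / a + b}.
Proof. by move=> a b; rewrite /quot_pi raddfD. Qed.

Fact quot_mulA : associative quot_mul.
Proof.
move=> u v w; rewrite -(quot_reprK u) -(quot_reprK v) -(quot_reprK w).
by rewrite -!quot_piM mulrA.
Qed.
Fact quot_mul1r : left_id (quot_pi 1) quot_mul.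
Proof. by move=> u; rewrite -(quot_reprK u) -quot_piM mul1r. Qed.
Fact quot_mulr1 : right_id (quot_pi 1) quot_mul.
Proof. by move=> u; rewrite -(quot_reprK u) -quot_piM mulr1. Qed.
Fact quot_mulDl : left_distributive quot_mul +%R.
Proof.
move=> u v w; rewrite -(quot_reprK u) -(quot_reprK v) -(quot_reprK w).
by rewrite -quot_piD -!quot_piM -quot_piD mulrDl.
Qed.
Fact quot_mulDr : right_distributive quot_mul +%R.
Proof.
move=> u v w; rewrite -(quot_reprK u) -(quot_reprK v) -(quot_reprK w).
by rewrite -quot_piD -!quot_piM -quot_piD mulrDr.
Qed.
HB.instance Definition _ := GRing.Zmodule_isPzRing.Build quot_ring
  quot_mulA quot_mul1r quot_mulr1 quot_mulDl quot_mulDr.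

Fact quot_pi_monoid : monoid_morphism quot_pi.
Proof. by split=> // a b; rewrite quot_piM. Qed.
HB.instance Definition _ := GRing.isZmodMorphism.Build A quot_ring quot_pi quot_piB.
HB.instance Definition _ := GRing.isMonoidMorphism.Build A quot_ring quot_pi
  quot_pi_monoid.

(* An [A]-module on which the equations [X] hold is a [quot_ring]-module. *)
Definition satisfies (M : lmodType A) : Prop :=
  forall x y, X x y -> forall m : M, x *: m = y *: m.

Definition descend (M : lmodType A) (hM : satisfies M) : Type := M.

Section Descend.
Variables (M : lmodType A) (hM : satisfies M).
HB.instance Definition _ := GRing.Zmodule.on (descend hM).

Definition descend_scale (u : quot_ring) (m : descend hM) : descend hM :=
  quot_repr u *: (m : M).

Lemma descend_scaleE a m : descend_scale (quot_pi a) m = a *: (m : M).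
Proof.
have : ideal_of (quot_repr (quot_pi a) - a) by apply/quot_piP; rewrite quot_reprK.
rewrite /descend_scale -[X in X *: _ = _](subrK a); move: (_ - a) => d Id.
suff d0 (p : M) : d *: p = 0 by rewrite scalerDl d0 add0r.
elim: Id => [b x y c Xxy||v w _ IHv _ IHw].
- by rewrite -!scalerA scalerBl (hM Xxy) subrr scaler0.
- by rewrite scale0r.
- by rewrite scalerDl IHv IHw addr0.
Qed.

Fact descend_scaleA u v m :
  descend_scale u (descend_scale v m) = descend_scale (u * v) m.
Proof.
rewrite -(quot_reprK u) -(quot_reprK v) -rmorphM /= !descend_scaleE.
by rewrite scalerA.
Qed.
Fact descend_scale1 : left_id 1 descend_scale.
Proof. by move=> m; rewrite -[1]/(quot_pi 1) descend_scaleE scale1r. Qed.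
Fact descend_scaleDr : right_distributive descend_scale +%R.
Proof. by move=> u m p; rewrite /descend_scale scalerDr. Qed.
Fact descend_scaleDl m : {morph descend_scale^~ m : u v / u + v}.
Proof.
move=> u v; rewrite -(quot_reprK u) -(quot_reprK v) -quot_piD !descend_scaleE.
by rewrite scalerDl.
Qed.
HB.instance Definition _ := GRing.Zmodule_isLmodule.Build quot_ring (descend hM)
  descend_scaleA descend_scale1 descend_scaleDr descend_scaleDl.
End Descend.

End TwoSidedQuotient.

(* The left [A]-module generated by [pres_gen] subject only to the equations
   [x *: pres_gen = y *: pres_gen] for [X x y]. *)
Section PresentedModule.
Variables (A : pzRingType) (X : A -> A -> Prop).

Inductive left_ideal_of : A -> Prop :=
| left_ideal_of_rel a x y : X x y -> left_ideal_of (a * (x - y))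
| left_ideal_of0 : left_ideal_of 0
| left_ideal_ofD u v : left_ideal_of u -> left_ideal_of v -> left_ideal_of (u + v).

Lemma left_ideal_ofM a u : left_ideal_of u -> left_ideal_of (a * u).
Proof.
elim=> [c x y Xxy||v w _ IHv _ IHw].
- by rewrite mulrA; exact: left_ideal_of_rel.
- by rewrite mulr0; exact: left_ideal_of0.
- by rewrite mulrDr; exact: left_ideal_ofD.
Qed.

Definition in_left_ideal : {pred A} := [pred u | `[< left_ideal_of u >]].

Lemma in_left_ideal_closed : zmod_closed in_left_ideal.
Proof.
split=> [|u v /asboolP Iu /asboolP Iv]; apply/asboolP; first exact: left_ideal_of0.
apply: left_ideal_ofD => //; have := left_ideal_ofM (-1) Iv.
by rewrite mulN1r.
Qed.
HB.instance Definition _ :=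
  GRing.isZmodClosed.Build A in_left_ideal in_left_ideal_closed.

Definition pres_mod : Type := {ideal_quot in_left_ideal}.
HB.instance Definition _ := GRing.Zmodule.on pres_mod.

Definition pres_pi (a : A) : pres_mod := \pi_{ideal_quot in_left_ideal} a.
Definition pres_repr (u : pres_mod) : A := repr (u : {ideal_quot in_left_ideal}).

Lemma pres_reprK : cancel pres_repr pres_pi.
Proof. exact: reprK. Qed.

Lemma pres_piP a b : pres_pi a = pres_pi b <-> left_ideal_of (a - b).
Proof.
split=> [/eqP|Iab]; last apply/eqP.
  by rewrite -[_ == _]Quotient.idealrBE => /asboolP.
by rewrite -[_ == _]Quotient.idealrBE; apply/asboolP.
Qed.

Fact pres_piD : {morph pres_pi : a b / a + b}.
Proof. by move=> a b; rewrite /pres_pi raddfD. Qed.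

Definition pres_scale (a : A) (u : pres_mod) := pres_pi (a * pres_repr u).

Lemma pres_scaleE a b : pres_scale a (pres_pi b) = pres_pi (a * b).
Proof.
apply/pres_piP; rewrite -mulrBr; apply: left_ideal_ofM.
by apply/pres_piP; rewrite pres_reprK.
Qed.

Fact pres_scaleA a b u : pres_scale a (pres_scale b u) = pres_scale (a * b) u.
Proof. by rewrite -(pres_reprK u) !pres_scaleE mulrA. Qed.
Fact pres_scale1 : left_id 1 pres_scale.
Proof. by move=> u; rewrite -(pres_reprK u) pres_scaleE mul1r. Qed.
Fact pres_scaleDr : right_distributive pres_scale +%R.
Proof.
move=> a u v; rewrite -(pres_reprK u) -(pres_reprK v) -pres_piD !pres_scaleE.
by rewrite mulrDr pres_piD.
Qed.
Fact pres_scaleDl u : {morph pres_scale^~ u : a b / a + b}.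
Proof.
by move=> a b; rewrite -(pres_reprK u) !pres_scaleE mulrDl pres_piD.
Qed.
HB.instance Definition _ := GRing.Zmodule_isLmodule.Build A pres_mod
  pres_scaleA pres_scale1 pres_scaleDr pres_scaleDl.

Definition pres_gen : pres_mod := pres_pi 1.

End PresentedModule.

(* Indices [r] of [y_r], [psi_r] and of the entries of a residue sequence are
   1-based, as usual for these algebras; residues live in 'Z_e, with 2 < e. *)
Section KLR.
Variables (F : fieldType) (e n : nat).

Definition res_seq := n.-tuple 'Z_e.

Definition res (i : res_seq) (r : nat) : 'Z_e := nth 0 i r.-1.

Definition swap (r : nat) (i : res_seq) : res_seq :=
  [tuple res i (if k.+1 == r then r.+1 else if k.+1 == r.+1 then r else k.+1)
    | k < n].

(* Generators: e(i), y_r for 1 <= r <= n, psi_r for 1 <= r <= n - 1. *)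
Definition klr_gen : Type :=
  (res_seq + {r : nat | (0 < r <= n)%N} + {r : nat | (0 < r < n)%N})%type.
HB.instance Definition _ := Choice.on klr_gen.

Definition klr_free := {malg F[{fmonom klr_gen}]}.
HB.instance Definition _ := GRing.Lalgebra.on klr_free.

Definition free_gen (g : klr_gen) : klr_free := << fmu g >>.
Definition free_e (i : res_seq) : klr_free := free_gen (inl (inl i)).
(* 0 is a dummy value for out-of-range indices *)
Definition free_y (r : nat) : klr_free :=
  if insub r is Some u then free_gen (inl (inr u)) else 0.
Definition free_psi (r : nat) : klr_free :=
  if insub r is Some u then free_gen (inr u) else 0.

Local Notation E := free_e.
Local Notation y := free_y.
Local Notation psi := free_psi.

Inductive klr_rel : klr_free -> klr_free -> Prop :=
| klr_ee i j : klr_rel (E i * E j) (if i == j then E i else 0)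
| klr_sum_e : klr_rel (\sum_(i : res_seq) E i) 1
| klr_ye r i : (0 < r <= n)%N -> klr_rel (y r * E i) (E i * y r)
| klr_psie r i : (0 < r < n)%N -> klr_rel (psi r * E i) (E (swap r i) * psi r)
| klr_yy r s : (0 < r <= n)%N -> (0 < s <= n)%N -> klr_rel (y r * y s) (y s * y r)
| klr_psiy r s : (0 < r < n)%N -> (0 < s <= n)%N -> s != r -> s != r.+1 ->
    klr_rel (psi r * y s) (y s * psi r)
| klr_psipsi r s : (0 < r < n)%N -> (0 < s < n)%N ->
    (r.+1 < s)%N || (s.+1 < r)%N ->
    klr_rel (psi r * psi s) (psi s * psi r)
| klr_psi_yS r i : (0 < r < n)%N ->
    klr_rel (psi r * y r.+1 * E i)
            ((y r * psi r + (res i r == res i r.+1)%:R) * E i)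
| klr_yS_psi r i : (0 < r < n)%N ->
    klr_rel (y r.+1 * psi r * E i)
            ((psi r * y r + (res i r == res i r.+1)%:R) * E i)
| klr_psi2 r i : (0 < r < n)%N ->
    klr_rel (psi r ^+ 2 * E i)
            (if res i r == res i r.+1 then 0
             else if res i r.+1 == res i r + 1 then (y r.+1 - y r) * E i
             else if res i r.+1 == res i r - 1 then (y r - y r.+1) * E i
             else E i)
| klr_braid r i : (0 < r)%N -> (r.+1 < n)%N ->
    klr_rel (psi r * psi r.+1 * psi r * E i)
            (if (res i r.+2 == res i r) && (res i r.+1 == res i r + 1)
             then (psi r.+1 * psi r * psi r.+1 + 1) * E i
             else if (res i r.+2 == res i r) && (res i r.+1 == res i r - 1)
             then (psi r.+1 * psi r * psi r.+1 - 1) * E i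
             else psi r.+1 * psi r * psi r.+1 * E i).

(* The field F acts through the central elements [quot_pi _ c%:A], so that
   modules over this ring and their linear maps are modules over the F-algebra
   and F-linear maps. *)
Definition klr : Type := quot_ring klr_rel.
HB.instance Definition _ := GRing.PzRing.on klr.

Definition klr_e (i : res_seq) : klr := quot_pi klr_rel (free_e i).
Definition klr_y (r : nat) : klr := quot_pi klr_rel (free_y r).
Definition klr_psi (r : nat) : klr := quot_pi klr_rel (free_psi r).

Section Cyclotomic.
Variables kappa1 kappa2 : 'Z_e.

Definition cyc_mult (i : 'Z_e) : nat := (kappa1 == i) + (kappa2 == i).

Inductive cyc_rel : klr -> klr -> Prop :=
| cyc_relI i : cyc_rel (klr_y 1 ^+ cyc_mult (res i 1) * klr_e i) 0.

Definition cyc_klr : Type := quot_ring cyc_rel.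
HB.instance Definition _ := GRing.PzRing.on cyc_klr.

(* [M] and [N] are modules over the cyclotomic quotient, and there is a nonzero
   homomorphism of such modules sending [x] to [w]. *)
Definition nonzero_cyc_hom (M N : lmodType klr) (x : M) (w : N) : Prop :=
  exists (hM : satisfies cyc_rel M) (hN : satisfies cyc_rel N)
         (f : {linear descend hM -> descend hN}),
    f x = w /\ exists u, f u != 0.

(* Bipartition ((n-m), (1^m)), for m <= n. *)
Definition res_bihook (m : nat) : res_seq :=
  [tuple if (k < m)%N then kappa2 - k%:R else kappa1 + (k - m)%:R | k < n].

Inductive bihook_rel (m : nat) : klr -> klr -> Prop :=
| bihook_e : bihook_rel m (klr_e (res_bihook m)) 1
| bihook_y r : (0 < r <= n)%N -> bihook_rel m (klr_y r) 0
| bihook_psi r : (0 < r < n)%N -> r != m -> bihook_rel m (klr_psi r) 0.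

Definition specht_bihook (m : nat) : Type := pres_mod (bihook_rel m).
HB.instance Definition _ m := GRing.Lmodule.on (specht_bihook m).
Definition z_bihook (m : nat) : specht_bihook m := pres_gen (bihook_rel m).

End Cyclotomic.

(* Hook (n-m, 1^m) placed in the component of charge kappa, for m <= n - 1. *)
Definition res_hook (kappa : 'Z_e) (m : nat) : res_seq :=
  [tuple if (k <= m)%N then kappa - k%:R else kappa + (k - m)%:R | k < n].

Inductive hook_rel (kappa : 'Z_e) (m : nat) : klr -> klr -> Prop :=
| hook_e : hook_rel kappa m (klr_e (res_hook kappa m)) 1
| hook_y r : (0 < r <= n)%N -> hook_rel kappa m (klr_y r) 0
| hook_psi r : (0 < r < n)%N -> r != m.+1 -> hook_rel kappa m (klr_psi r) 0
| hook_garnir : (m.+2 <= n)%N ->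
    hook_rel kappa m (\prod_(1 <= r < m.+2) klr_psi r) 0.

Definition specht_hook (kappa : 'Z_e) (m : nat) : Type := pres_mod (hook_rel kappa m).
HB.instance Definition _ kappa m := GRing.Lmodule.on (specht_hook kappa m).
Definition z_hook (kappa : 'Z_e) (m : nat) : specht_hook kappa m :=
  pres_gen (hook_rel kappa m).

(* psi_{a-1} psi_{a-2} ... psi_j, which is 1 if a = j *)
Definition psi_down (a j : nat) : klr := \prod_(r <- rev (index_iota j a)) klr_psi r.

(* For s = [:: a_j; a_{j+1}; ...; a_l], the product
   psi_down a_j j * psi_down a_{j+1} (j+1) * ... * psi_down a_l l. *)
Definition psi_word (j : nat) (s : seq nat) : klr :=
  \prod_(k < size s) psi_down (nth 0%N s k) (j + k).

Definition v_bihook (kappa1 kappa2 : 'Z_e) (m : nat) (a : seq nat) :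
  specht_bihook kappa1 kappa2 m := psi_word 1 a *: z_bihook kappa1 kappa2 m.

Definition v_hook (kappa : 'Z_e) (m : nat) (b : seq nat) :
  specht_hook kappa m := psi_word 2 b *: z_hook kappa m.

End KLR.

(* Main.v *)
(* A standard basis vector [v(a_1, ..., a_m)] of a bihook Specht module is a
   shuffle of the leg letters, of residues [kappa2, kappa2 - 1, ...], with the arm
   letters, of residues [kappa1, kappa1 + 1, ...], the leg letters being at the
   positions [a_i].  The difference of the residues that a leg letter and an arm
   letter would have at a position depends on that position only; as [e >= 3],
   the positions where it vanishes are at least three apart, and every
   generator sends a word to [0] or to a signed word by a rule involving at most
   three adjacent letters around such a position.  These rules define a
   module of words, in which distinct words are linearly independent.
   Conversely, by induction on the number of inversions, the rules hold in any
   module generated by a vector satisfying the bihook relations.  A hook module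
   of charge [kappa] is the bihook module of charges [kappa + 1], [kappa] modulo the
   words that begin with an arm letter.  All relations required of the images can
   thus be read off from words.  The images are non-zero since they are words, or
   for hook codomains since [chi_m] maps them to words. *)

From HB Require Import structures.
Require Import Defs.
From mathcomp Require Import all_boot all_algebra.
From mathcomp Require Import boolp finmap ring zify.
From mathcomp.multinomials Require Import monalg.

Set Implicit Arguments.
Unset Strict Implicit.
Unset Printing Implicit Defensive.

Import GRing.Theory.
Local Open Scope ring_scope.

(** * Shuffle words and the local operators on them *)

(** The rules are forced. A word with an arm letter at [r] and a leg letter at [r+1] is [psi_r] of
    the word with that pair exchanged, so [psi_r] and [y_r] on it follow from the relations for the
    square of [psi_r] and for moving [y] past [psi]. Two equal letters next to such a pair are
    handled by the braid relation, whose error term exchanges letters at distance two. The same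
    formulas are needed in the free module on words, which detects non-vanishing, and in an
    arbitrary generated module, where words may become dependent. They are therefore stated for
    functions from words to any abelian group, with [ket] and [vec] as the two instances.
    Non-vanishing needs linearity over [klr] only, so a map of type [chi_m] is used for every charge
    [kappa], with target of charges [kappa], [kappa - 1], and nothing cyclotomic is asked of this
    target; this is what covers hook codomains of charge [kappa2]. *)

(* A word records the interleaving of the leg letters ([true]) and the arm
   letters ([false]).  Positions [1], ..., [n] carry the residues; position [0]
   is a padding leg letter and all positions past [n] are padding arm letters,
   so that the operators below need no boundary conditions. *)
Definition word := nat -> bool.

Definition sw (p q : nat) (w : word) : word :=
  fun k => if k == p then w q else if k == q then w p else w k.

(* [z p] says that a leg letter and an arm letter placed at [p] would have equal
   residues.  The operators act on functions of words: [act_y r v w] is the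
   image under [v] of [y_r w], so they compose in the opposite order. *)
Section Action.
Variables (z : nat -> bool) (N : zmodType).
Implicit Types (v : word -> N) (w : word).

(** If [z p] holds and [w] has an arm letter at [p] followed by a leg letter, then [w] is [psi_p] of
    the exchanged word [w']; passing [y_p], resp. [y_(p+1)], through [psi_p] leaves [-w'], resp.
    [+w']. Hence the two terms of [act_y]. *)
Definition act_low p v w : N :=
  if [&& z p, ~~ w p & w p.+1] then v (sw p p.+1 w) else 0.

Definition act_y r v w : N := act_low r.-1 v w - act_low r v w.

(* The error term of the braid relation for the letters at [p], [p+1], [p+2]. *)
Definition act_jump p v w : N :=
  if ~~ w p && w p.+2 then
    if w p.+1 then v (sw p p.+2 w) else - v (sw p p.+2 w)
  else 0.

(** A leg-arm pair is always exchanged, which is how standard basis vectors arise. An arm-leg pair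
    is exchanged back only where the square of [psi_r] is the identity. The jumps collect the [y]
    terms of that square and the error terms of the braid relation. *)
Definition act_psi r v w : N :=
  (if (w r != w r.+1) && (w r || ~~ [|| z r.-1, z r | z r.+1])
   then v (sw r r.+1 w) else 0)
  + (if z r.-1 then act_jump r.-1 v w else 0)
  + (if z r.+1 then act_jump r v w else 0).

(* The generator [psi_r] is encoded by [(true, r)] and [y_r] by [(false, r)]. *)
Definition act (o : bool * nat) v := if o.1 then act_psi o.2 v else act_y o.2 v.

End Action.

(* Since [e >= 3], equal residues can only occur at positions at least [3] apart. *)
Definition sparse (z : nat -> bool) := forall p, z p -> ~~ z p.+1 /\ ~~ z p.+2.

(* The relations only involve a bounded window of letters.  They are checked by
   computing, for all windows, the formal sums of signed windows produced by
   each side. *)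
Section Window.
Implicit Types (s zs : seq bool) (l : seq (bool * seq bool)).

Definition swl p q s :=
  set_nth false (set_nth false s p (nth false s q)) q (nth false s p).

Definition low_l zs p s :=
  if [&& nth false zs p, ~~ nth false s p & nth false s p.+1]
  then [:: (false, swl p p.+1 s)] else [::].

Definition neg l := [seq (~~ x.1, x.2) | x <- l].

Definition jump_l p s :=
  if ~~ nth false s p && nth false s p.+2
  then [:: (~~ nth false s p.+1, swl p p.+2 s)] else [::].

Definition gen_l zs (o : bool * nat) s :=
  let r := o.2 in
  if o.1 then
    (if (nth false s r != nth false s r.+1)
        && (nth false s r || ~~ [|| nth false zs r.-1, nth false zs r | nth false zs r.+1])
     then [:: (false, swl r r.+1 s)] else [::])
    ++ (if nth false zs r.-1 then jump_l r.-1 s else [::])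
    ++ (if nth false zs r.+1 then jump_l r s else [::])
  else low_l zs r.-1 s ++ neg (low_l zs r s).

Fixpoint run_l zs (os : seq (bool * nat)) s : seq (bool * seq bool) :=
  if os is o :: os' then
    flatten [seq (if x.1 then neg (run_l zs os' x.2) else run_l zs os' x.2)
            | x <- gen_l zs o s]
  else [:: (false, s)].

(** Terms are removed in pairs of opposite sign. [k] is fuel: running out of it with terms left only
    makes the test fail, so soundness does not depend on the bound chosen in [check]. *)
Fixpoint cancels k l :=
  if k is k'.+1 then
    if l is x :: l' then ((~~ x.1, x.2) \in l') && cancels k' (rem (~~ x.1, x.2) l')
    else true
  else nilp l.

Fixpoint bits m : seq (seq bool) :=
  if m is m'.+1 then [seq b :: s | b <- [:: true; false], s <- bits m'] else [:: [::]].

Definition sparse_l zs :=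
  all (fun p => nth false zs p ==> ~~ nth false zs p.+1 && ~~ nth false zs p.+2)
      (iota 0 (size zs)).

Definition relation_l zs s (rel : seq (bool * seq (bool * nat))) :=
  flatten [seq (if x.1 then neg (run_l zs x.2 s) else run_l zs x.2 s) | x <- rel].

(** [rel] may depend on the window because the right-hand sides of the KLR relations depend on
    residues. The bounds on [o.2] keep the letters [o.2 - 1] to [o.2 + 2] read by a generator inside
    the window. *)
Definition check m (rel : seq bool -> seq bool -> seq (bool * seq (bool * nat))) :=
  all (fun zs => sparse_l zs ==>
    all (fun s =>
      all (fun x => all (fun o => (0 < o.2)%N && (o.2.+2 < m)%N) x.2) (rel zs s)
      && cancels m.*2.+2 (relation_l zs s (rel zs s))) (bits m)) (bits m).

End Window.

Definition wapp (s : seq bool) (t : word) : word :=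
  fun k => if (k < size s)%N then nth false s k else t (k - size s)%N.

Definition signed (N : zmodType) (b : bool) (x : N) := if b then - x else x.

(** * Formal sums of windows compute the operators on words *)

Section WindowSemantics.
Variables (zs : seq bool) (zt : word) (N : zmodType) (v : word -> N) (t : word).
Local Notation z := (wapp zs zt).
Implicit Types (s : seq bool) (l : seq (bool * seq bool)).

Definition ev (f : word -> N) l := \sum_(x <- l) signed x.1 (f (wapp x.2 t)).

Lemma size_swl p q s : (p < size s)%N -> (q < size s)%N -> size (swl p q s) = size s.
Proof.
move=> hp hq; rewrite !size_set_nth.
by rewrite (maxn_idPr hp) (maxn_idPr hq).
Qed.

Lemma wappE s k : (k < size s)%N -> wapp s t k = nth false s k.
Proof. by rewrite /wapp => ->. Qed.

Lemma sw_wapp p q s : (p < size s)%N -> (q < size s)%N -> (p != q) ->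
  sw p q (wapp s t) = wapp (swl p q s) t.
Proof.
move=> hp hq pq; apply/funext => k; rewrite /sw /wapp size_swl // hp hq.
rewrite !nth_set_nth /=.
case: (eqVneq k p) => [->|kp]; first by rewrite hp nth_set_nth /= (negbTE pq) eqxx.
case: (eqVneq k q) => [->|kq]; first by rewrite hq.
by rewrite nth_set_nth /= (negbTE kp).
Qed.

Lemma ev_neg f l : ev f (neg l) = - ev f l.
Proof.
rewrite /ev big_map -sumrN; apply: eq_bigr => -[[] s] _ //=.
by rewrite opprK.
Qed.

Lemma ev_cat f l l' : ev f (l ++ l') = ev f l + ev f l'.
Proof. exact: big_cat. Qed.

Lemma ev_low f p s : (p.+1 < size s)%N -> (p < size zs)%N ->
  act_low z p f (wapp s t) = ev f (low_l zs p s).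
Proof.
move=> hp hz; rewrite /act_low /low_l !wappE ?(ltnW hp) // /wapp hz.
case: ifP => _; last by rewrite /ev big_nil.
by rewrite /ev big_seq1 /= -/(wapp s t) sw_wapp // ?(ltnW hp) // neq_ltn leqnn.
Qed.

Lemma ev_jump f p s : (p.+2 < size s)%N ->
  act_jump p f (wapp s t) = ev f (jump_l p s).
Proof.
move=> hp; rewrite /act_jump /jump_l !wappE ?(ltnW hp) // ?(ltnW (ltnW hp)) //.
case: ifP => _; last by rewrite /ev big_nil.
rewrite /ev big_seq1 /= sw_wapp ?(ltnW (ltnW hp)) // ?neq_ltn ?leqnSn //.
by case: (nth _ s p.+1).
Qed.

Definition in_window m (o : bool * nat) := (0 < o.2)%N && (o.2.+2 < m)%N.

Lemma ev_gen f o s : size s = size zs -> in_window (size zs) o ->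
  act z o f (wapp s t) = ev f (gen_l zs o s).
Proof.
case: o => [[] [|r]] //= sz; rewrite /in_window /= /act /gen_l /= => hr.
- rewrite !ev_cat /act_psi /=.
  have [h1 h2 h3 h4] : [/\ r < size s, r.+1 < size s, r.+2 < size s
      & r.+3 < size s]%N by rewrite sz; split=> //; do ?[exact: hr|apply: ltnW].
  rewrite /wapp -sz h1 h2 h3 -/(wapp s t) addrA; congr (_ + _ + _).
  + case: ifP => _; last by rewrite /ev big_nil.
    by rewrite /ev big_seq1 /= sw_wapp // neq_ltn leqnn.
  + by case: ifP => _; rewrite ?ev_jump // /ev big_nil.
  + by case: ifP => _; rewrite ?ev_jump // /ev big_nil.
- rewrite /act_y /= ev_cat ev_neg.
  have [h1 h2 h3] : [/\ r < size s, r.+1 < size s & r.+2 < size s]%N.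
    by rewrite sz; split=> //; do ?[exact: hr|apply: ltnW].
  by rewrite !ev_low // -sz.
Qed.

Lemma size_gen o s x : size s = size zs -> in_window (size zs) o ->
  x \in gen_l zs o s -> size x.2 = size zs.
Proof.
case: o => [[] [|r]] //= sz; rewrite /in_window /= /gen_l /= => hr.
- have [h1 h2 h3 h4] : [/\ r < size s, r.+1 < size s, r.+2 < size s
      & r.+3 < size s]%N by rewrite sz; split=> //; do ?[exact: hr|apply: ltnW].
  rewrite !mem_cat /jump_l => /orP[|/orP[]];
    do 2?[case: ifP => // _]; rewrite inE => /eqP -> /=; by rewrite size_swl.
- have [h1 h2 h3] : [/\ r < size s, r.+1 < size s & r.+2 < size s]%N.
    by rewrite sz; split=> //; do ?[exact: hr|apply: ltnW].
  rewrite mem_cat /low_l => /orP[|]; case: ifP => //= _; rewrite inE => /eqP -> /=;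
    by rewrite size_swl.
Qed.

Lemma ev_run os s : size s = size zs -> all (in_window (size zs)) os ->
  foldr (act z (N:=N)) v os (wapp s t) = ev v (run_l zs os s).
Proof.
elim: os s => [|o os IH] s sz /=; first by rewrite /ev big_seq1.
case/andP=> ho hos; rewrite ev_gen // /ev big_flatten /= big_map.
rewrite big_seq [RHS]big_seq; apply: eq_bigr => -[b u] /(size_gen sz ho) /= su.
rewrite IH //; case: b => //=; first by rewrite -/(ev v _) -/(ev v _) ev_neg.
Qed.

Lemma ev_cancels k l : cancels k l -> ev v l = 0.
Proof.
elim: k l => [|k IH] [|[b s] l] //=; rewrite ?/ev ?big_nil //=.
case/andP=> hin /IH; rewrite /ev big_cons (perm_big _ (perm_to_rem hin)) big_cons /= => ->.
by rewrite addr0; case: b {hin} => /=; rewrite (addrN, addNr).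
Qed.

End WindowSemantics.

Lemma mem_bits s : s \in bits (size s).
Proof.
elim: s => // b s IH; apply/allpairsP; exists (b, s) => /=.
by split=> //; case: b; rewrite !inE.
Qed.

Lemma wapp_mkseq m w : w = wapp (mkseq w m) (fun k => w (m + k)%N).
Proof.
apply/funext => k; rewrite /wapp size_mkseq; case: ltnP => h.
  by rewrite nth_mkseq.
by rewrite subnKC.
Qed.

Lemma sparse_mkseq z m : sparse z -> sparse_l (mkseq z m).
Proof.
move=> hz; apply/allP => p; rewrite size_mkseq mem_iota /= add0n => hp.
have h k : nth false (mkseq z m) k -> z k.
  case: (ltnP k m) => hk; first by rewrite nth_mkseq.
  by rewrite nth_default ?size_mkseq.
apply/implyP => /h /hz[z1 z2]; apply/andP.
by split; apply/negP => /h; apply/negP.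
Qed.

(** * The relations at the beginning of a word *)

Section LocalRelations.
Variables (z : nat -> bool) (N : zmodType).
Hypothesis z_sparse : sparse z.
Implicit Types (v : word -> N) (w : word).

(** Letters beyond the window are neither read nor moved, and truncating a sparse set of positions
    keeps it sparse; so an identity on infinite words reduces to finitely many windows. *)
Lemma checkP m rel v w : check m rel ->
  \sum_(x <- rel (mkseq z m) (mkseq w m))
     signed x.1 (foldr (act z (N:=N)) v x.2 w) = 0.
Proof.
move=> /allP /(_ (mkseq z m)); set zs := mkseq z m; set s := mkseq w m.
have sz : size zs = m by rewrite size_mkseq.
have ss : size s = size zs by rewrite !size_mkseq.
have := mem_bits zs; rewrite sz => hz /(_ hz) /implyP /(_ (sparse_mkseq m z_sparse)).
move=> /allP /(_ s); have := mem_bits s; rewrite ss sz => hs /(_ hs) /andP[win].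
move=> /(@ev_cancels _ v (fun k => w (m + k)%N)).
move=> ev0; rewrite -[RHS]ev0 /ev big_flatten /= big_map.
rewrite big_seq [RHS]big_seq; apply: eq_bigr => -[b os] hx.
have hos : all (in_window (size zs)) os by rewrite sz; exact: (allP win _ hx).
rewrite /= [in LHS](wapp_mkseq m w) [in LHS](wapp_mkseq m z) -/zs -/s.
rewrite ev_run //.
by case: b {hx} => //=; rewrite -/(ev _ v _) -/(ev _ v _) ev_neg.
Qed.

Local Notation psi := (act_psi z).
Local Notation y := (act_y z).
Local Notation "s `: k" := (nth false s k) (at level 2).

(** The error term of the braid relation without residues: the condition encodes [i_(r+2) = i_r],
    and the letter at [r] then decides which of the two neighbouring residues [i_(r+1)] is. *)
Definition braid_defect r v w : N :=
  if (w r != w r.+2) && (if w r == w r.+1 then z r else z r.+1)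
  then signed (w r) (v w) else 0.

Lemma loc_braid v w :
  psi 1 (psi 2 (psi 1 v)) w = psi 2 (psi 1 (psi 2 v)) w + braid_defect 1 v w.
Proof.
pose rel := fun zs s : seq bool =>
  [:: (false, [:: (true, 1%N); (true, 2%N); (true, 1%N)]);
      (true, [:: (true, 2%N); (true, 1%N); (true, 2%N)])]
  ++ (if (s`:1 != s`:3) && (if s`:1 == s`:2 then zs`:1 else zs`:2)
      then [:: (~~ s`:1, [::])] else [::]).
have: check 5 rel by vm_compute.
move=> /(checkP v w); rewrite /rel /act big_cat /= !big_cons big_nil /= addr0.
move/eqP; rewrite -addrA addr_eq0 opprD opprK => /eqP ->; congr (_ + _).
rewrite /braid_defect; case: ifP; rewrite ?big_nil ?oppr0 // => _.
by rewrite big_seq1 /=; case: (w 1%N); rewrite //= opprK.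
Qed.

Lemma loc_psi_sqr v w :
  psi 1 (psi 1 v) w =
    if (w 1 != w 2) && z 1 then 0
    else if (if w 1 then ~~ w 2 && z 0 else w 2 ==> z 2) then y 2 v w - y 1 v w
    else if (if w 1 then ~~ w 2 ==> z 2 else w 2 && z 0) then y 1 v w - y 2 v w
    else v w.
Proof.
pose rel := fun zs s : seq bool => (false, [:: (true, 1%N); (true, 1%N)]) ::
  (if (s`:1 != s`:2) && zs`:1 then [::]
   else if (if s`:1 then ~~ s`:2 && zs`:0 else s`:2 ==> zs`:2)
   then [:: (true, [:: (false, 2%N)]); (false, [:: (false, 1%N)])]
   else if (if s`:1 then ~~ s`:2 ==> zs`:2 else s`:2 && zs`:0)
   then [:: (false, [:: (false, 2%N)]); (true, [:: (false, 1%N)])]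
   else [:: (true, [::])]).
have: check 5 rel by vm_compute.
move=> /(checkP v w); rewrite /rel /act big_cons /= => /eqP.
rewrite addr_eq0 => /eqP ->.
do 3?case: ifP => _; rewrite ?big_cons ?big_nil /= ?addr0 ?oppr0 //.
- by rewrite opprD opprK.
- by move: (act_y z 1 v w) (act_y z 2 v w) => y1 y2; rewrite opprB.
by rewrite opprK.
Qed.

(* [os] and [os'] are equal up to the scalar [delta_(i_1, i_2)]. *)
Definition delta_rel os os' (zs s : seq bool) :=
  [:: (false, os); (true, os')] ++
  (if (s`:1 != s`:2) && zs`:1 then [:: (true, [::])] else [::] : seq (bool * seq (bool * nat))).

Lemma delta_relP os os' v w : check 5 (delta_rel os os') ->
  foldr (act z (N:=N)) v os w =
  foldr (act z (N:=N)) v os' w + (if (w 1 != w 2) && z 1 then v w else 0).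
Proof.
move=> /(checkP v w); rewrite /delta_rel big_cat /= !big_cons big_nil /= addr0.
move/eqP; rewrite -addrA addr_eq0 opprD opprK => /eqP ->; congr (_ + _).
by case: ifP => _; rewrite ?big_nil ?oppr0 // big_seq1 /= opprK.
Qed.

Lemma loc_y_psi v w :
  y 2 (psi 1 v) w = psi 1 (y 1 v) w + (if (w 1 != w 2) && z 1 then v w else 0).
Proof. exact: (@delta_relP [:: (false, 2%N); (true, 1%N)] [:: (true, 1%N); (false, 1%N)]). Qed.

Lemma loc_psi_y v w :
  psi 1 (y 2 v) w = y 1 (psi 1 v) w + (if (w 1 != w 2) && z 1 then v w else 0).
Proof. exact: (@delta_relP [:: (true, 1%N); (false, 2%N)] [:: (false, 1%N); (true, 1%N)]). Qed.

Lemma comm_relP o o' v w :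
  check 7 (fun _ _ => [:: (false, [:: o; o']); (true, [:: o'; o])]) ->
  act z o (act z o' v) w = act z o' (act z o v) w.
Proof.
move=> /(checkP v w); rewrite !big_cons big_nil /= addr0.
by move/eqP; rewrite subr_eq0 => /eqP.
Qed.

(* For [o.2 <= o'.2], the generators [o] and [o'] commute in the algebra. *)
Definition commuting (o o' : bool * nat) : bool :=
  if o.1 then (o.2.+1 < o'.2)%N else o'.1 ==> (o.2 < o'.2)%N.

(** The generator at 1 reads positions 0 to 3, so up to index 4 the two generators may share
    letters; a window of length seven contains them all. *)
Lemma near_comm b o v w :
  commuting (b, 1%N) o -> (0 < o.2 <= 4)%N ->
  act z (b, 1%N) (act z o v) w = act z o (act z (b, 1%N) v) w.
Proof.
case: o => b' [|[|[|[|[|r']]]]] // h _; apply: comm_relP; move: h.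
all: by case: b; case: b' => // _; vm_compute.
Qed.

End LocalRelations.

(** * Relations at arbitrary positions *)

Definition joinw b (f g : word) : word := fun k => if (k < b)%N then f k else g (k - b)%N.
Definition shiftw b (f : word) : word := fun k => f (b + k)%N.

Lemma joinw_shiftw b f : joinw b f (shiftw b f) = f.
Proof. by apply/funext => k; rewrite /joinw /shiftw; case: ltnP => // /subnKC ->. Qed.

Lemma joinwD b f g k : joinw b f g (b + k)%N = g k.
Proof. by rewrite /joinw ltnNge leq_addr /= addKn. Qed.

Lemma sw_joinwD b p q f g : sw (b + p) (b + q) (joinw b f g) = joinw b f (sw p q g).
Proof.
apply/funext => k; rewrite {1}/sw !joinwD /joinw /sw; case: (ltnP k b) => h.
  by rewrite !ltn_eqF ?ltn_addr.
by rewrite -(eqn_add2l b (k - b) p) -(eqn_add2l b (k - b) q) subnKC.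
Qed.

Lemma sw_joinw b p q f g : (p < b)%N -> (q < b)%N ->
  sw p q (joinw b f g) = joinw b (sw p q f) g.
Proof.
move=> hp hq; apply/funext => k; rewrite /joinw /sw hp hq.
case: (ltnP k b) => // h.
by rewrite !gtn_eqF // (leq_trans _ h).
Qed.

Section Shift.
Variables (z : nat -> bool) (N : zmodType).
Implicit Types (v : word -> N) (w : word).

(** With [0 < r] the predecessor [r.-1] is not truncated, hence commutes with translation by [b]. *)
Lemma act_shift b t r v f g : (0 < r)%N ->
  act z (t, (b + r)%N) v (joinw b f g) =
  act (shiftw b z) (t, r) (fun u => v (joinw b f u)) g.
Proof.
case: r => // r _; case: t; rewrite /act /= /act_psi /act_y /act_low /act_jump;
by rewrite !addnS /= -!addnS -?addnS !joinwD !sw_joinwD /shiftw !addnS.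
Qed.

Lemma act_prefix b o v f g : (o.2.+2 < b)%N ->
  act z o v (joinw b f g) = act z o (fun u => v (joinw b u g)) f.
Proof.
case: o => t r /= h; have h1 := ltnW h; have h2 := ltnW h1.
have h3 : (r.-1 < b)%N by apply: leq_ltn_trans h2; apply: leq_pred.
have h4 : (r.-1.+1 < b)%N by apply: leq_ltn_trans h1; rewrite ltnS leq_pred.
have h5 : (r.-1.+2 < b)%N by apply: leq_ltn_trans h; rewrite !ltnS leq_pred.
case: t; rewrite /act /= /act_psi /act_y /act_low /act_jump !sw_joinw // /joinw.
  by rewrite h h1 h2 h3 h4 h5.
by rewrite h1 h2 h3 h4.
Qed.

Definition additive_fun (T : Type) (phi : (T -> N) -> N) :=
  [/\ phi (fun=> 0) = 0, forall f, phi (fun x => - f x) = - phi f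
    & forall f g, phi (fun x => f x + g x) = phi f + phi g].

(** The operators are signed sums of values, so additive functionals pass through them. This serves
    twice: for an operator acting on other letters, and for scaling by a ring element. *)
Lemma act_exchange z' o (T : Type) (phi : (T -> N) -> N) (V : T -> word -> N) w :
  additive_fun phi ->
  phi (fun x => act z' o (V x) w) = act z' o (fun u => phi (fun x => V x u)) w.
Proof.
case=> phi0 phiN phiD; case: o => -[] r; rewrite /act /= /act_psi /act_y /act_low /act_jump.
  by rewrite !phiD; congr (_ + _ + _); do 3?[case: ifP => _ //].
by rewrite !phiD !phiN; congr (_ - _); case: ifP => _.
Qed.

Lemma additive_eval (T : Type) (x : T) : additive_fun (fun f : T -> N => f x).
Proof. by split. Qed.

Lemma additive_0 (T : Type) : additive_fun (fun f : T -> N => 0).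
Proof. by split=> *; rewrite ?oppr0 ?addr0. Qed.

Lemma additive_opp (T : Type) (phi : (T -> N) -> N) :
  additive_fun phi -> additive_fun (fun f => - phi f).
Proof. by case=> h0 hN hD; split=> *; rewrite ?h0 ?hN ?hD ?oppr0 ?opprD. Qed.

Lemma additive_add (T : Type) (phi chi : (T -> N) -> N) :
  additive_fun phi -> additive_fun chi -> additive_fun (fun f => phi f + chi f).
Proof.
case=> h0 hN hD [k0 kN kD]; split=> *.
- by rewrite h0 k0 addr0.
- by rewrite hN kN opprD.
- by rewrite hD kD addrACA.
Qed.

Lemma additive_if (T : Type) b (phi chi : (T -> N) -> N) :
  additive_fun phi -> additive_fun chi ->
  additive_fun (fun f => if b then phi f else chi f).
Proof. by case: b. Qed.

Lemma act_additive o w : additive_fun (fun v => act z o v w).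
Proof.
case: o => -[] r; rewrite /act /= /act_psi /act_y /act_low /act_jump.
  by do ![apply: additive_add | apply: additive_if | apply: additive_0
         | apply: additive_eval | apply: additive_opp].
by do ![apply: additive_add | apply: additive_opp | apply: additive_if
       | apply: additive_0 | apply: additive_eval].
Qed.

(** Cut before position 4: the generator at 1 only touches the first four letters and [o] only the
    remaining ones, and two operators in separate variables commute by additivity. *)
Lemma far_comm b o v w : (4 < o.2)%N ->
  act z (b, 1%N) (act z o v) w = act z o (act z (b, 1%N) v) w.
Proof.
case: o => t [|[|[|[|[|r]]]]] // _; rewrite -(joinw_shiftw 4 w).
move: (shiftw 4 w) => g; have -> : r.+1.+4 = (4 + r.+1)%N by [].
rewrite (@act_prefix 4) // (@act_shift 4 t r.+1) //.
have -> : (fun u => act z (t, 4 + r.+1)%N v (joinw 4 u g)) =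
    (fun u => act (shiftw 4 z) (t, r.+1) (fun u' => v (joinw 4 u u')) g).
  by apply/funext => u; rewrite (@act_shift 4 t r.+1).
rewrite (act_exchange _ _ (fun u u' => v (joinw 4 u u')) _ (act_additive (b, 1%N) w)).
by congr (act _ _ _ _); apply/funext => u; rewrite act_prefix.
Qed.

End Shift.

Section Relations.
Variables (z : nat -> bool) (N : zmodType).
Hypothesis z_sparse : sparse z.
Implicit Types (v : word -> N) (w : word).

Lemma sparse_shiftw b : sparse (shiftw b z).
Proof. by move=> p hp; rewrite /shiftw !addnS; apply: z_sparse. Qed.

Lemma act_comm o o' v w : (0 < o.2 <= o'.2)%N -> commuting o o' ->
  act z o (act z o' v) w = act z o' (act z o v) w.
Proof.
case: o => t [|b]; case: o' => t' [|r'] //= hb.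
have -> : r'.+1 = (b + (r' - b).+1)%N by rewrite addnS subnKC.
have -> : b.+1 = (b + 1)%N by rewrite addn1.
move=> hc; rewrite -[w](joinw_shiftw b); move: (shiftw b w) => g.
have A c r u : (0 < r)%N -> (fun u' => act z (c, (b + r)%N) u (joinw b w u')) =
    act (shiftw b z) (c, r) (fun u' => u (joinw b w u')).
  by move=> hr; apply/funext => u'; rewrite act_shift.
rewrite !act_shift // !A //.
have hc' : commuting (t, 1%N) (t', (r' - b).+1).
  move: hc; rewrite /commuting /=; case: t => /=; last by rewrite ltn_add2l.
  by rewrite -[(b + 1).+1]addnS ltn_add2l.
case: (leqP (r' - b).+1 4) => h; last exact: far_comm.
by apply: near_comm => //; apply: sparse_shiftw.
Qed.


Let shift_fun b t r v f : (0 < r)%N ->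
  (fun g => act z (t, (b + r)%N) v (joinw b f g)) =
  act (shiftw b z) (t, r) (fun g => v (joinw b f g)).
Proof. by move=> r0; apply/funext => g; rewrite act_shift. Qed.

Local Notation psi := (act_psi z).
Local Notation y := (act_y z).

Let psiE r : psi r = act z (true, r) :> ((word -> N) -> word -> N).
Proof. by []. Qed.

Let yE r : y r = act z (false, r) :> ((word -> N) -> word -> N).
Proof. by []. Qed.

Lemma act_braid r v w : (0 < r)%N ->
  psi r (psi r.+1 (psi r v)) w = psi r.+1 (psi r (psi r.+1 v)) w + braid_defect z r v w.
Proof.
case: r => // b _.
rewrite !psiE ?yE.
rewrite /braid_defect -(addn3 b) -(addn2 b) -(addn1 b) -[w](joinw_shiftw b); move: (shiftw b w) => g.
rewrite !act_shift // !shift_fun // !joinwD.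
exact: (loc_braid (@sparse_shiftw b) (fun u => v (joinw b w u)) g).
Qed.

Lemma act_psi_sqr r v w : (0 < r)%N ->
  psi r (psi r v) w =
    if (w r != w r.+1) && z r then 0
    else if (if w r then ~~ w r.+1 && z r.-1 else w r.+1 ==> z r.+1)
    then y r.+1 v w - y r v w
    else if (if w r then ~~ w r.+1 ==> z r.+1 else w r.+1 && z r.-1)
    then y r v w - y r.+1 v w
    else v w.
Proof.
case: r => // b _ /=.
rewrite !psiE ?yE.
rewrite -(addn2 b) -(addn1 b) -[in z b](addn0 b) -[w](joinw_shiftw b); move: (shiftw b w) => g.
rewrite !act_shift // !shift_fun // !joinwD.
exact: (loc_psi_sqr (@sparse_shiftw b) (fun u => v (joinw b w u)) g).
Qed.

Lemma act_y_psi r v w : (0 < r)%N ->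
  y r.+1 (psi r v) w = psi r (y r v) w + (if (w r != w r.+1) && z r then v w else 0).
Proof.
case: r => // b _.
rewrite !psiE ?yE.
rewrite -(addn2 b) -(addn1 b) -[w](joinw_shiftw b); move: (shiftw b w) => g.
rewrite !act_shift // !shift_fun // !joinwD.
exact: (loc_y_psi (@sparse_shiftw b) (fun u => v (joinw b w u)) g).
Qed.

Lemma act_psi_y r v w : (0 < r)%N ->
  psi r (y r.+1 v) w = y r (psi r v) w + (if (w r != w r.+1) && z r then v w else 0).
Proof.
case: r => // b _.
rewrite !psiE ?yE.
rewrite -(addn2 b) -(addn1 b) -[w](joinw_shiftw b); move: (shiftw b w) => g.
rewrite !act_shift // !shift_fun // !joinwD.
exact: (loc_psi_y (@sparse_shiftw b) (fun u => v (joinw b w u)) g).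
Qed.

Lemma act_yy r s v w : (0 < r)%N -> (0 < s)%N -> y r (y s v) w = y s (y r v) w.
Proof.
move=> r0 s0; case: (leqP r s) => [|/ltnW] h.
  by apply: (@act_comm (false, r) (false, s)); rewrite //= r0.
by apply/esym/(@act_comm (false, s) (false, r)); rewrite //= s0.
Qed.

Lemma act_psi_y_far r s v w : (0 < r)%N -> (0 < s)%N -> s != r -> s != r.+1 ->
  y s (psi r v) w = psi r (y s v) w.
Proof.
move=> r0 s0 sr sr1; case: (ltngtP s r) sr => // h _.
  by apply: (@act_comm (false, s) (true, r)); rewrite /= ?s0 ?(ltnW h) ?h.
apply/esym/(@act_comm (true, r) (false, s)); rewrite /commuting /= ?r0 ?(ltnW h) //.
by rewrite ltn_neqAle h eq_sym sr1.
Qed.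

Lemma act_psi_far r s v w : (0 < r)%N -> (0 < s)%N -> (r.+1 < s)%N || (s.+1 < r)%N ->
  psi r (psi s v) w = psi s (psi r v) w.
Proof.
move=> r0 s0 /orP[] h.
  by apply: (@act_comm (true, r) (true, s)); rewrite //= r0 (ltnW (ltnW h)).
by apply/esym/(@act_comm (true, s) (true, r)); rewrite //= s0 (ltnW (ltnW h)).
Qed.

End Relations.

(** * Residues *)

(* The number of leg letters before position [k]. *)
Fixpoint nL (w : word) k : nat := if k is k'.+1 then (w k' + nL w k')%N else 0%N.

Lemma nL_succ w k : nL w k.+1 = (w k + nL w k)%N.
Proof. by []. Qed.

Lemma nL_sw p q w k : (p < q)%N ->
  (nL (sw p q w) k + (p < k <= q)%N * w p = nL w k + (p < k <= q)%N * w q)%N.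
Proof.
move=> pq; elim: k => [|k] //=; rewrite /sw ltnS.
case: (ltngtP k p) => [kp|pk|->] /=.
- by rewrite (ltn_eqF (ltn_trans kp pq)) ?mul0n ?addn0 => ->.
- case: (ltngtP k q) => [kq|qk|->] /=; rewrite ?mul1n ?mul0n ?addn0 => h.
  + by rewrite -!addnA h.
  + by rewrite h.
  + by rewrite addnC h addnC.
- rewrite pq !mul1n !mul0n !addn0 => ->.
  by rewrite addnC [(w q + _)%N]addnC addnA.
Qed.

Section Residues.
Variables (R : comNzRingType) (kappa1 kappa2 : R).
Hypothesis two_neq0 : 2%:R != 0 :> R.

(* With [l] leg letters before it, a leg letter at [p] has residue
   [kappa2 + 1 - l] and an arm letter [kappa1 + p - l]; the difference does not
   depend on [l]. *)
Definition special (p : nat) : bool := kappa1 - kappa2 - 1 + p%:R == 0.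

Definition rs (w : word) (k : nat) : R :=
  if w k then kappa2 + 1 - (nL w k)%:R else kappa1 + k%:R - (nL w k)%:R.

Let one_neq0 : 1 != 0 :> R. Proof. exact: oner_neq0. Qed.

Let eqr_diff (c x y : R) : x - y = c -> (x == y) = (c == 0).
Proof. by move=> <-; rewrite subr_eq0. Qed.

Let eqr_diffN (c x y : R) : y - x = c -> (x == y) = (c == 0).
Proof. by rewrite eq_sym; apply: eqr_diff. Qed.

Lemma sparse_special : sparse special.
Proof.
move=> p /eqP hp; rewrite /special -[p.+2]addn2 -[p.+1]addn1 !natrD !addrA hp !add0r.
by rewrite one_neq0 two_neq0.
Qed.

Let rsE w b : rs w b = if w b then kappa2 + 1 - (nL w b)%:R else kappa1 + b%:R - (nL w b)%:R.
Proof. by []. Qed.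

Let nL1 w b : (nL w b.+1)%:R = (w b)%:R + (nL w b)%:R :> R.
Proof. by rewrite natrD. Qed.

(** The count [nL w r] cancels in differences of nearby residues. Thus the case distinctions of the
    KLR relations become conditions on letters and special positions, the very ones used in the
    local relations. *)
Lemma rs_eq w r : (rs w r == rs w r.+1) = (w r != w r.+1) && special r.
Proof.
rewrite !rsE !nL1 /special; case: (w r); case: (w r.+1) => /=.
- by rewrite (@eqr_diff 1) ?(negbTE one_neq0) //; ring.
- by rewrite (@eqr_diffN (kappa1 - kappa2 - 1 + r%:R)) //; ring.
- by rewrite (@eqr_diff (kappa1 - kappa2 - 1 + r%:R)) //; ring.
- by rewrite (@eqr_diffN 1) ?(negbTE one_neq0) //; ring.
Qed.

Lemma rs_succ w r : (0 < r)%N -> (rs w r.+1 == rs w r + 1) =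
  if w r then ~~ w r.+1 && special r.-1 else w r.+1 ==> special r.+1.
Proof.
case: r => // b _; rewrite !rsE !nL1 /special /=; case: (w b.+1); case: (w b.+2) => /=.
- by rewrite (@eqr_diffN 2%:R) ?(negbTE two_neq0) //; ring.
- by rewrite (@eqr_diff (kappa1 - kappa2 - 1 + b%:R)) //; ring.
- by rewrite (@eqr_diffN (kappa1 - kappa2 - 1 + b.+2%:R)) //; ring.
- by rewrite (@eqr_diff 0) ?eqxx //; ring.
Qed.

Lemma rs_pred w r : (0 < r)%N -> (rs w r.+1 == rs w r - 1) =
  if w r then ~~ w r.+1 ==> special r.+1 else w r.+1 && special r.-1.
Proof.
case: r => // b _; rewrite !rsE !nL1 /special /=; case: (w b.+1); case: (w b.+2) => /=.
- by rewrite (@eqr_diffN 0) ?eqxx //; ring.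
- by rewrite (@eqr_diff (kappa1 - kappa2 - 1 + b.+2%:R)) //; ring.
- by rewrite (@eqr_diffN (kappa1 - kappa2 - 1 + b%:R)) //; ring.
- by rewrite (@eqr_diff 2%:R) ?(negbTE two_neq0) //; ring.
Qed.

Lemma rs_eq2 w r : (rs w r.+2 == rs w r) =
  (w r != w r.+2) && (if w r == w r.+1 then special r else special r.+1).
Proof.
rewrite !rsE !nL1 /special /=; case: (w r); case: (w r.+1); case: (w r.+2) => /=.
- by rewrite (@eqr_diffN 2%:R) ?(negbTE two_neq0) //; ring.
- by rewrite (@eqr_diff (kappa1 - kappa2 - 1 + r%:R)) //; ring.
- by rewrite (@eqr_diffN 1) ?(negbTE one_neq0) //; ring.
- by rewrite (@eqr_diff (kappa1 - kappa2 - 1 + r.+1%:R)) //; ring.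
- by rewrite (@eqr_diffN (kappa1 - kappa2 - 1 + r.+1%:R)) //; ring.
- by rewrite (@eqr_diff 1) ?(negbTE one_neq0) //; ring.
- by rewrite (@eqr_diffN (kappa1 - kappa2 - 1 + r%:R)) //; ring.
- by rewrite (@eqr_diff 2%:R) ?(negbTE two_neq0) //; ring.
Qed.

Lemma braid_defectE (N : zmodType) (v : word -> N) w r : (0 < r)%N ->
  braid_defect special r v w =
    if (rs w r.+2 == rs w r) && (rs w r.+1 == rs w r + 1) then v w
    else if (rs w r.+2 == rs w r) && (rs w r.+1 == rs w r - 1) then - v w
    else 0.
Proof.
move=> r0; rewrite /braid_defect rs_eq2 rs_succ // rs_pred //.
have [h0 h1] : (special r -> special r.-1 = false)
    /\ (special r.+1 -> special r.-1 = false).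
  by case: r r0 => // b _; split=> h; apply/negP => /sparse_special[]; rewrite h.
case: (w r); case: (w r.+1); case: (w r.+2) => //=.
- by case: (special r).
- by case: (special r.+1) h1 => // ->.
- by case: (special r.+1) h1 => // ->.
- by case: (special r).
Qed.

Lemma nL_out p q w k : (p < q)%N -> ~~ (p < k <= q)%N -> nL (sw p q w) k = nL w k.
Proof. by move=> pq /negbTE hk; have := nL_sw w k pq; rewrite hk !mul0n !addn0. Qed.

Lemma rs_out p q w k : (p < q)%N -> ~~ (p <= k <= q)%N -> rs (sw p q w) k = rs w k.
Proof.
move=> pq hk; rewrite !rsE nL_out //; last first.
  by apply: contra hk => /andP[/ltnW -> ->].
rewrite /sw; case: eqP => [kp|_]; first by rewrite kp leqnn ltnW in hk.
by case: eqP => [kq|_] //; rewrite kq leqnn ltnW in hk.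
Qed.

Lemma nLS_sw p q w : (p < q)%N -> nL (sw p q w) p.+1 = (w q + nL w p)%N.
Proof. by move=> pq /=; rewrite nL_out ?ltnn // /sw eqxx. Qed.

Lemma rs_sw1 p w k : w p != w p.+1 ->
  rs (sw p p.+1 w) k = if k == p then rs w p.+1 else if k == p.+1 then rs w p else rs w k.
Proof.
move=> h; case: (eqVneq k p) => [->|kp].
  rewrite !rsE nL_out ?ltnn // nL1 /sw eqxx.
  by case: (w p) h; case: (w p.+1) => //= _; ring.
case: (eqVneq k p.+1) => [->|kp1].
  rewrite !rsE nLS_sw // natrD /sw eqxx gtn_eqF //.
  by case: (w p) h; case: (w p.+1) => //= _; ring.
by rewrite rs_out //; lia.
Qed.

(** The exchanged letters have equal residues at a special position; this is why [y_r] preserves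
    weights. *)
Lemma rs_low p w k : special p -> ~~ w p -> w p.+1 -> rs (sw p p.+1 w) k = rs w k.
Proof.
move=> zp wp wp1; rewrite rs_sw1 ?wp1 ?(negbTE wp) //.
have /eqP e : rs w p == rs w p.+1 by rewrite rs_eq zp wp1 (negbTE wp).
by case: eqP => [->|_] //; case: eqP => [->|_].
Qed.

(** Two of the three residues involved coincide because of the special position, so exchanging the
    outer letters permutes residues just as [s_r] does. A jump thus has the weight that [psi_r] must
    produce. *)
Lemma rs_jump r p w k : (p = r.-1 /\ special p \/ p = r /\ special r.+1) -> (0 < r)%N ->
  ~~ w p -> w p.+2 ->
  rs (sw p p.+2 w) k =
    if k == r then rs w r.+1 else if k == r.+1 then rs w r else rs w k.
Proof.
move=> hp r0 wp wp2.
have hk : (p <= k <= p.+2)%N -> [|| k == p, k == p.+1 | k == p.+2]%N by lia.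
case: (boolP (p <= k <= p.+2)%N) => [/hk{}hk|hk2]; last first.
  have [kr kr1] : k != r /\ k != r.+1 by lia.
  by rewrite rs_out // (negbTE kr) (negbTE kr1).
have s0 : sw p p.+2 w p = true by rewrite /sw eqxx.
have s1 : sw p p.+2 w p.+1 = w p.+1 by rewrite /sw !ifF //; lia.
have s2 : sw p p.+2 w p.+2 = false by rewrite /sw eqxx ifF ?(negbTE wp) //; lia.
have nn : nL (sw p p.+2 w) p = nL w p by rewrite nL_out ?ltnn.
have E0 : rs (sw p p.+2 w) p = kappa2 + 1 - (nL w p)%:R by rewrite rsE s0 nn.
have E1 : rs (sw p p.+2 w) p.+1 = if w p.+1 then kappa2 - (nL w p)%:R
    else kappa1 + p%:R - (nL w p)%:R.
  by rewrite rsE nL1 s0 s1 nn; case: (w p.+1) => /=; ring.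
have E2 : rs (sw p p.+2 w) p.+2 = kappa1 + p%:R + 1 - (nL w p)%:R - (w p.+1)%:R.
  by rewrite rsE !nL1 s0 s1 s2 nn; case: (w p.+1) => /=; ring.
have F0 : rs w p = kappa1 + p%:R - (nL w p)%:R by rewrite rsE (negbTE wp).
have F1 : rs w p.+1 = if w p.+1 then kappa2 + 1 - (nL w p)%:R
    else kappa1 + p%:R + 1 - (nL w p)%:R.
  by rewrite rsE nL1 (negbTE wp); case: (w p.+1) => /=; ring.
have F2 : rs w p.+2 = kappa2 + 1 - (nL w p)%:R - (w p.+1)%:R.
  by rewrite rsE !nL1 wp2 (negbTE wp); case: (w p.+1) => /=; ring.
have [n0 n1 n2] : [/\ (p == p.+1) = false, (p == p.+2) = false & (p.+1 == p.+2) = false].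
  by rewrite !ltn_eqF.
have [m0 m1 m2] : [/\ (p.+1 == p) = false, (p.+2 == p) = false & (p.+2 == p.+1) = false].
  by rewrite !gtn_eqF.
case: hp => -[hp]; rewrite /special => /eqP hz.
- have e1 : kappa1 = kappa2 + 1 - p%:R.
    by rewrite -[LHS]subr0 -hz; ring.
  have -> : r = p.+1 by lia.
  case/or3P: hk => /eqP ->; rewrite ?eqxx ?n0 ?n1 ?n2 ?m0 ?m1 ?m2 ?E0 ?E1 ?E2 ?F0 ?F1 ?F2 e1;
  by case: (w p.+1) => /=; ring.
- have e1 : kappa1 = kappa2 - p%:R.
    by rewrite -[LHS]subr0 -hz hp; ring.
  rewrite -hp.
  case/or3P: hk => /eqP ->; rewrite ?eqxx ?n0 ?n1 ?n2 ?m0 ?m1 ?m2 ?E0 ?E1 ?E2 ?F0 ?F1 ?F2 e1;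
  by case: (w p.+1) => /=; ring.
Qed.

End Residues.

Lemma two_neq0_Zp e : (3 <= e)%N -> 2%:R != 0 :> 'Z_e.
Proof. by case: e => [|[|[|e]]]. Qed.

(** * Residue sequences of words and compatibility with the idempotents *)

Section ResidueSequences.
Variables (e n : nat).
Implicit Types (i : res_seq e n).

Lemma res_tuple (f : nat -> 'Z_e) r : (0 < r <= n)%N ->
  res [tuple f k.+1 | k < n] r = f r.
Proof.
case: r => // r /= hr; rewrite /res /= (nth_map (Ordinal hr)) ?size_enum_ord //.
by rewrite nth_enum_ord.
Qed.

Lemma res_inj i j : (forall r, (0 < r <= n)%N -> res i r = res j r) -> i = j.
Proof.
move=> h; apply: eq_from_tnth => k; have := h k.+1 (ltn_ord k).
by rewrite /res /= -!tnth_nth.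
Qed.

Lemma res_swap r i k : (0 < r < n)%N -> (0 < k <= n)%N ->
  res (swap r i) k = if k == r then res i r.+1 else if k == r.+1 then res i r else res i k.
Proof.
move=> hr hk.
rewrite /swap (res_tuple (fun k => res i (if k == r then r.+1 else if k == r.+1 then r else k)) hk).
by do 2?case: eqP.
Qed.

Lemma swapK r : (0 < r < n)%N -> involutive (@swap e n r).
Proof.
move=> hr i; apply: res_inj => k hk; rewrite res_swap //.
have [h1 h2] : (0 < r.+1 <= n)%N /\ (0 < r <= n)%N by lia.
rewrite !res_swap // eqxx (gtn_eqF (ltnSn r)).
by case: eqP => [->|_] //; case: eqP => [->|_] //; rewrite eqxx.
Qed.

Variables (kappa1 kappa2 : 'Z_e).
Definition resw (w : word) : res_seq e n := [tuple rs kappa1 kappa2 w k.+1 | k < n].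

Lemma res_resw w r : (0 < r <= n)%N -> res (resw w) r = rs kappa1 kappa2 w r.
Proof. exact: res_tuple. Qed.

Hypothesis e3 : (3 <= e)%N.
Local Notation sp := (special kappa1 kappa2).

Lemma resw_low p w : sp p -> ~~ w p -> w p.+1 -> resw (sw p p.+1 w) = resw w.
Proof.
by move=> *; apply: res_inj => r hr; rewrite !res_resw // rs_low // two_neq0_Zp.
Qed.

Lemma resw_sw r w : (0 < r < n)%N -> w r != w r.+1 -> resw (sw r r.+1 w) = swap r (resw w).
Proof.
move=> hr h; apply: res_inj => k hk; have [h1 h2] : (0 < r.+1 <= n)%N /\ (0 < r <= n)%N by lia.
by rewrite res_swap // !res_resw // rs_sw1 // two_neq0_Zp.
Qed.

Lemma resw_jump r p w : (0 < r < n)%N -> (p = r.-1 /\ sp p \/ p = r /\ sp r.+1) ->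
  ~~ w p -> w p.+2 -> resw (sw p p.+2 w) = swap r (resw w).
Proof.
move=> hr hp wp wp2; apply: res_inj => k hk; have [h1 h2] : (0 < r.+1 <= n)%N /\ (0 < r <= n)%N by lia.
rewrite res_swap // !res_resw // (rs_jump (two_neq0_Zp e3) _ hp) //.
by case/andP: hr.
Qed.

Variable N : zmodType.
Implicit Types (v : word -> N) (w : word).

Definition act_e i v w : N := if i == resw w then v w else 0.

Lemma act_y_e r i v w : act_y sp r (act_e i v) w = act_e i (act_y sp r v) w.
Proof.
have L p : act_low sp p (act_e i v) w = if i == resw w then act_low sp p v w else 0.
  rewrite /act_low /act_e; case: ifP => [|_]; last by rewrite if_same.
  by case/and3P=> h1 h2 h3; rewrite resw_low.
by rewrite /act_y !L /act_e; case: eqP; rewrite ?subr0.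
Qed.

Lemma act_psi_e r i v w : (0 < r < n)%N ->
  act_psi sp r (act_e i v) w = if i == swap r (resw w) then act_psi sp r v w else 0.
Proof.
move=> hr; have J p : p = r.-1 /\ sp p \/ p = r /\ sp r.+1 ->
    act_jump p (act_e i v) w = if i == swap r (resw w) then act_jump p v w else 0.
  move=> hp; rewrite /act_jump /act_e; case: ifP => [/andP[h1 h2]|_]; last by rewrite if_same.
  by rewrite (resw_jump hr hp) //; case: eqP => _ //; rewrite oppr0 if_same.
rewrite /act_psi.
have -> : (if sp r.-1 then act_jump r.-1 (act_e i v) w else 0) =
    if i == swap r (resw w) then if sp r.-1 then act_jump r.-1 v w else 0 else 0.
  by case: ifP => h; [rewrite J //; left | rewrite if_same].
have -> : (if sp r.+1 then act_jump r (act_e i v) w else 0) =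
    if i == swap r (resw w) then if sp r.+1 then act_jump r v w else 0 else 0.
  by case: ifP => h; [rewrite J //; right | rewrite if_same].
have -> : (if (w r != w r.+1) && (w r || ~~ [|| sp r.-1, sp r | sp r.+1])
           then act_e i v (sw r r.+1 w) else 0) =
    if i == swap r (resw w) then
      if (w r != w r.+1) && (w r || ~~ [|| sp r.-1, sp r | sp r.+1])
      then v (sw r r.+1 w) else 0 else 0.
  by rewrite /act_e; case: ifP => [/andP[h _]|_]; [rewrite resw_sw | rewrite if_same].
by case: eqP => // _; rewrite !addr0.
Qed.

End ResidueSequences.

(** * The module of words *)

Section LinearExtension.
Variables (F : fieldType) (K : choiceType) (V : lmodType F).
Implicit Types (h : K -> V) (a : {malg F[K]}).

Definition lin_ext h a : V := \sum_(k <- msupp a) a@_k *: h k.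

Lemma lin_extE h a (d : {fset K}) : (msupp a `<=` d)%fset ->
  lin_ext h a = \sum_(k <- d) a@_k *: h k.
Proof.
move=> le; rewrite [LHS](big_fset_incl _ le) => //= x xd /mcoeff_outdom ->.
by rewrite scale0r.
Qed.

Lemma lin_extU h c k : lin_ext h << c *g k >> = c *: h k.
Proof. by rewrite (lin_extE _ msuppU_le) big_seq_fset1 mcoeffUU. Qed.

Lemma lin_ext_linear h : linear (lin_ext h).
Proof.
move=> c a b; set d := (msupp a `|` msupp b `|` msupp (c *: a + b))%fset.
have da : (msupp a `<=` d)%fset by rewrite /d -fsetUA fsubsetUl.
have db : (msupp b `<=` d)%fset by rewrite /d fsetUAC fsubsetUr.
have dab : (msupp (c *: a + b) `<=` d)%fset by rewrite fsubsetUr.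
rewrite (lin_extE _ da) (lin_extE _ db) (lin_extE _ dab) scaler_sumr -big_split.
by apply: eq_bigr => k _; rewrite mcoeffD mcoeffZ scalerDl scalerA.
Qed.

HB.instance Definition _ h := GRing.isLinear.Build F {malg F[K]} V *:%R (lin_ext h) (lin_ext_linear h).

Lemma malg_expand a : a = \sum_(k <- msupp a) a@_k *: << k >>.
Proof.
rewrite [LHS]monalgE; apply: eq_bigr => k _; apply/malgP => k'.
by rewrite mcoeffZ !mcoeffU mulr_natr.
Qed.

Lemma malg_linear_eq (f g : {malg F[K]} -> V) :
  linear f -> linear g -> (forall k, f << k >> = g << k >>) -> f =1 g.
Proof.
move=> hf hg fg a.
pose f' := HB.pack_for {linear {malg F[K]} -> V} f (GRing.isLinear.Build _ _ _ _ f hf).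
pose g' := HB.pack_for {linear {malg F[K]} -> V} g (GRing.isLinear.Build _ _ _ _ g hg).
rewrite (malg_expand a) -[LHS]/(f' _) -[RHS]/(g' _) !linear_sum; apply: eq_bigr => k _.
by rewrite !linearZ /= fg.
Qed.

End LinearExtension.

HB.instance Definition _ := gen_eqMixin word.
HB.instance Definition _ := gen_choiceMixin word.

Lemma malg_scalerAr (F : fieldType) (K : monomType) (c : F) (a b : {malg F[K]}) :
  a * (c *: b) = c *: (a * b).
Proof.
rewrite -[c *: b]mul_malgC -[c *: _]mul_malgC !mulrA; congr (_ * _).
rewrite !malgM_def fgmulgU fgmulUg.
by apply: eq_bigr => k _; rewrite mulrC mulm1 mul1m.
Qed.

(* The parameters [n], [kappa1] and [kappa2] determine the module structure. *)
Definition fock (F : fieldType) (e n : nat) (kappa1 kappa2 : 'Z_e) : Type := {malg F[word]}.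

Section Fock.
Variables (F : fieldType) (e n : nat) (kappa1 kappa2 : 'Z_e).
Local Notation sp := (special kappa1 kappa2).
Local Notation free := (klr_free F e n).

HB.instance Definition _ := GRing.Zmodule.on (@fock F e n kappa1 kappa2).
Local Notation fock := (@fock F e n kappa1 kappa2).

Definition ket (w : word) : fock := << w >>.

Definition gen_ket (g : klr_gen e n) (w : word) : fock :=
  match g with
  | inl (inl i) => act_e kappa1 kappa2 i ket w
  | inl (inr r) => act_y sp (val r) ket w
  | inr r => act_psi sp (val r) ket w
  end.

Definition mon_act (m : seq (klr_gen e n)) (u : {malg F[word]}) : {malg F[word]} :=
  foldr (fun g => lin_ext (gen_ket g : word -> {malg F[word]})) u m.

Lemma mon_act_linear m : linear (mon_act m).
Proof.
elim: m => [|g m IH] c u u' //=.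
by rewrite IH linearP.
Qed.

Definition fock_scale (a : free) (u : fock) : fock :=
  lin_ext (fun m : {fmonom klr_gen e n} => mon_act m u) (a : {malg F[{fmonom klr_gen e n}]}).

Lemma fock_scaleU c m u : fock_scale << c *g m >> u = (c *: mon_act m u : {malg F[word]}).
Proof. exact: lin_extU. Qed.

Lemma fock_scale_linear a c (u u' : {malg F[word]}) :
  fock_scale a (c *: u + u' : {malg F[word]}) =
  (c *: (fock_scale a u : {malg F[word]}) + fock_scale a u' : {malg F[word]}).
Proof.
rewrite /fock_scale /lin_ext scaler_sumr -big_split; apply: eq_bigr => m _ /=.
by rewrite mon_act_linear scalerDr !scalerA mulrC.
Qed.

Fact fock_scaleDl u : {morph fock_scale^~ u : a b / a + b}.
Proof. by move=> a b; rewrite /fock_scale raddfD. Qed.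

Fact fock_scale1 : left_id 1 fock_scale.
Proof. by move=> u; rewrite [LHS](fock_scaleU 1) /mon_act fm1 /= scale1r. Qed.

Fact fock_scaleDr : right_distributive fock_scale +%R.
Proof. by move=> a u u'; have := fock_scale_linear a 1 u u'; rewrite !scale1r. Qed.

Fact fock_scaleA a b u : fock_scale a (fock_scale b u) = fock_scale (a * b) u.
Proof.
move: a; apply: malg_linear_eq.
- by move=> c x y; rewrite /fock_scale linearP.
- by move=> c x y; rewrite /fock_scale mulrDl -scalerAl linearP.
move=> k; move: b; apply: malg_linear_eq.
- move=> c x y; rewrite -fock_scale_linear; congr fock_scale.
  by rewrite /fock_scale linearP.
- move=> c x y; rewrite /fock_scale.
  by rewrite mulrDr malg_scalerAr linearP.
move=> l; rewrite !fock_scaleU !scale1r.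
have -> : (<< k >> : free) * << l >> = << mmul k l >>.
  by rewrite [LHS]malgM_def fgmulUU mulr1.
by rewrite fock_scaleU scale1r /mon_act fmM foldr_cat.
Qed.

HB.instance Definition _ := GRing.Zmodule_isLmodule.Build free fock
  fock_scaleA fock_scale1 fock_scaleDr fock_scaleDl.

Lemma gen_scale g w : free_gen F g *: ket w = gen_ket g w.
Proof.
rewrite [LHS]fock_scaleU scale1r /mon_act fmU /=.
by rewrite [LHS]lin_extU scale1r.
Qed.

Lemma free_e_ket i w : free_e F i *: ket w = act_e kappa1 kappa2 i ket w.
Proof. exact: gen_scale. Qed.

Lemma free_y_ket r w : (0 < r <= n)%N -> free_y F e n r *: ket w = act_y sp r ket w.
Proof. by move=> hr; rewrite /free_y insubT gen_scale. Qed.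

Lemma free_psi_ket r w : (0 < r < n)%N -> free_psi F e n r *: ket w = act_psi sp r ket w.
Proof. by move=> hr; rewrite /free_psi insubT gen_scale. Qed.

Lemma fock_eq a b : (forall w, a *: ket w = b *: ket w) -> forall u : fock, a *: u = b *: u.
Proof.
move=> h; apply: malg_linear_eq; [| |exact: h];
by move=> c x y; exact: fock_scale_linear.
Qed.

Lemma act_scale (A : pzRingType) (M : lmodType A) z o (a : A) (v : word -> M) w :
  a *: act z o v w = act z o (fun u => a *: v u) w.
Proof.
apply: (@act_exchange M z o unit (fun f => a *: f tt) (fun=> v)).
by split=> *; rewrite ?scaler0 ?scalerN ?scalerDr.
Qed.

Lemma y_scale (A : pzRingType) (M : lmodType A) z r (a : A) (v : word -> M) w :
  a *: act_y z r v w = act_y z r (fun u => a *: v u) w.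
Proof. exact: (act_scale z (false, r)). Qed.

Lemma psi_scale (A : pzRingType) (M : lmodType A) z r (a : A) (v : word -> M) w :
  a *: act_psi z r v w = act_psi z r (fun u => a *: v u) w.
Proof. exact: (act_scale z (true, r)). Qed.

Lemma psi_scale_fun (A : pzRingType) (M : lmodType A) z r (a : A) (v : word -> M) :
  (fun w => a *: act_psi z r v w) = act_psi z r (fun u => a *: v u).
Proof. by apply/funext => w; apply: psi_scale. Qed.

Hypothesis e3 : (3 <= e)%N.

Let sp_sparse : sparse sp.
Proof. exact: sparse_special (two_neq0_Zp e3). Qed.


Let e_fun i : (fun w => free_e F i *: ket w) = act_e kappa1 kappa2 i ket.
Proof. by apply/funext => w; apply: free_e_ket. Qed.

Let y_fun r : (0 < r <= n)%N -> (fun w => free_y F e n r *: ket w) = act_y sp r ket.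
Proof. by move=> hr; apply/funext => w; apply: free_y_ket. Qed.

Let psi_fun r : (0 < r < n)%N -> (fun w => free_psi F e n r *: ket w) = act_psi sp r ket.
Proof. by move=> hr; apply/funext => w; apply: free_psi_ket. Qed.

Let scale_e a i w : a *: act_e kappa1 kappa2 i ket w =
  if i == resw n kappa1 kappa2 w then a *: ket w else 0.
Proof. by rewrite /act_e; case: eqP; rewrite ?scaler0. Qed.

(** Linearity reduces to basis words. A product of generators applied to [ket w] becomes a composite
    of operators in reverse order, the idempotent on the right tests the residues of [w], and the
    relations between operators conclude. *)
Lemma fock_satisfies : satisfies (@klr_rel F e n) fock.
Proof.
move=> a b hab; apply: fock_eq => w; case: hab.
- move=> i j; rewrite -scalerA free_e_ket scale_e free_e_ket /act_e.
  case: (eqVneq i j) => [->|ij]; first by rewrite free_e_ket /act_e; case: eqP.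
  by rewrite scale0r; case: eqP => // <-; rewrite (negbTE ij).
- rewrite scaler_suml scale1r (bigD1 (resw n kappa1 kappa2 w)) //= big1.
    by rewrite free_e_ket /act_e eqxx addr0.
  by move=> i hi; rewrite free_e_ket /act_e (negbTE hi).
- move=> r i hr; rewrite -[LHS]scalerA -[RHS]scalerA free_e_ket scale_e free_y_ket // y_scale e_fun.
  by rewrite act_y_e.
- move=> r i hr; rewrite -[LHS]scalerA -[RHS]scalerA free_e_ket scale_e free_psi_ket // psi_scale e_fun.
  by rewrite act_psi_e // (can_eq (swapK hr)).
- move=> r s hr hs; rewrite -[LHS]scalerA -[RHS]scalerA (free_y_ket _ hr) (free_y_ket _ hs).
  rewrite [LHS]y_scale [RHS]y_scale (y_fun hr) (y_fun hs).
  by apply: act_yy => //; [case/andP: hs | case/andP: hr].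
- move=> r s hr hs sr sr1; rewrite -[LHS]scalerA -[RHS]scalerA (free_y_ket _ hs) (free_psi_ket _ hr).
  rewrite [LHS]y_scale [RHS]psi_scale (y_fun hs) (psi_fun hr). have [/andP[r0 _] /andP[s0 _]] := (hr, hs).
  exact: act_psi_y_far.
- move=> r s hr hs h; rewrite -[LHS]scalerA -[RHS]scalerA (free_psi_ket _ hr) (free_psi_ket _ hs).
  rewrite [LHS]psi_scale [RHS]psi_scale (psi_fun hr) (psi_fun hs).
  have [/andP[r0 _] /andP[s0 _]] := (hr, hs).
  by apply: act_psi_far => //; rewrite orbC.
- move=> r i hr; have [h1 h2 r0] : [/\ 0 < r.+1 <= n, 0 < r <= n & 0 < r]%N by split; lia.
  rewrite -[LHS]scalerA -[LHS]scalerA -[RHS]scalerA free_e_ket !scale_e.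
  case: eqP => [->|_]; last by rewrite !scaler0.
  rewrite !res_resw // scalerDl -[X in _ = X + _]scalerA (free_psi_ket _ hr) (free_y_ket _ h1).
  rewrite [LHS]y_scale [X in _ = X + _]psi_scale (y_fun h2) (psi_fun hr) act_y_psi // rs_eq ?two_neq0_Zp //.
  by case: ifP; rewrite ?scale1r ?scale0r.
- move=> r i hr; have [h1 h2 r0] : [/\ 0 < r.+1 <= n, 0 < r <= n & 0 < r]%N by split; lia.
  rewrite -[LHS]scalerA -[LHS]scalerA -[RHS]scalerA free_e_ket !scale_e.
  case: eqP => [->|_]; last by rewrite !scaler0.
  rewrite !res_resw // scalerDl -[X in _ = X + _]scalerA (free_psi_ket _ hr) (free_y_ket _ h2).
  rewrite [LHS]psi_scale [X in _ = X + _]y_scale (y_fun h1) (psi_fun hr) act_psi_y // rs_eq ?two_neq0_Zp //.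
  by case: ifP; rewrite ?scale1r ?scale0r.
- move=> r i hr; have [h1 h2 r0] : [/\ 0 < r.+1 <= n, 0 < r <= n & 0 < r]%N by split; lia.
  rewrite expr2 -[LHS]scalerA -[LHS]scalerA free_e_ket !scale_e.
  have -> : (if res i r == res i r.+1 then 0
      else if res i r.+1 == res i r + 1 then (free_y F e n r.+1 - free_y F e n r) * free_e F i
      else if res i r.+1 == res i r - 1 then (free_y F e n r - free_y F e n r.+1) * free_e F i
      else free_e F i) *: ket w = if i == resw n kappa1 kappa2 w then
    (if res i r == res i r.+1 then 0
      else if res i r.+1 == res i r + 1 then free_y F e n r.+1 *: ket w - free_y F e n r *: ket w
      else if res i r.+1 == res i r - 1 then free_y F e n r *: ket w - free_y F e n r.+1 *: ket w
      else ket w) else 0.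
    case: ifP => _; first by rewrite scale0r if_same.
    by do 2?[case: ifP => _; first by rewrite -[LHS]scalerA free_e_ket scale_e scalerBl];
      rewrite free_e_ket.
  case: eqP => [->|_]; last by rewrite !scaler0.
  rewrite (free_psi_ket _ hr) [LHS]psi_scale (psi_fun hr) act_psi_sqr // (free_y_ket _ h1) (free_y_ket _ h2).
  by rewrite !res_resw // rs_eq ?two_neq0_Zp // rs_succ ?two_neq0_Zp // rs_pred ?two_neq0_Zp.
- move=> r i r0 hr; have [h0 h1 h2 h3 h4] : [/\ 0 < r < n, 0 < r.+1 < n, 0 < r <= n,
    0 < r.+1 <= n & 0 < r.+2 <= n]%N by split; lia.
  rewrite -[LHS]scalerA -[LHS]scalerA -[LHS]scalerA free_e_ket !scale_e.
  have -> : (if (res i r.+2 == res i r) && (res i r.+1 == res i r + 1)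
        then (free_psi F e n r.+1 * free_psi F e n r * free_psi F e n r.+1 + 1) * free_e F i
      else if (res i r.+2 == res i r) && (res i r.+1 == res i r - 1)
        then (free_psi F e n r.+1 * free_psi F e n r * free_psi F e n r.+1 - 1) * free_e F i
      else free_psi F e n r.+1 * free_psi F e n r * free_psi F e n r.+1 * free_e F i) *: ket w =
    if i == resw n kappa1 kappa2 w then
      free_psi F e n r.+1 *: (free_psi F e n r *: (free_psi F e n r.+1 *: ket w)) +
     (if (res i r.+2 == res i r) && (res i r.+1 == res i r + 1) then ket w
      else if (res i r.+2 == res i r) && (res i r.+1 == res i r - 1) then - ket w else 0) else 0.
    have M3 x y t (u : fock) : (x * y * t) *: u = x *: (y *: (t *: u)) by rewrite -[LHS]scalerA -[LHS]scalerA.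
    case: ifP => _; last case: ifP => _; rewrite -[LHS]scalerA free_e_ket scale_e;
    by rewrite ?scalerBl ?scalerDl ?scale1r ?M3 ?addr0.
  case: eqP => [->|_]; last by rewrite !scaler0.
  rewrite (free_psi_ket _ h0) (free_psi_ket _ h1) [X in _ *: X = _]psi_scale (psi_fun h1).
  rewrite [LHS]psi_scale psi_scale_fun (psi_fun h0).
  rewrite [X in _ = _ *: X + _]psi_scale (psi_fun h0) [X in _ = X + _]psi_scale psi_scale_fun (psi_fun h1).
  rewrite !res_resw // act_braid // braid_defectE ?two_neq0_Zp //.
Qed.
End Fock.

Lemma swK p q : involutive (sw p q).
Proof.
move=> w; apply/funext => k; rewrite /sw !eqxx.
case: (eqVneq k p) => [->|kp]; first by case: eqP => // ->.
by case: (eqVneq k q) => [->|kq] //.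
Qed.

Lemma sw_far p q w : (p.+1 < q)%N || (q.+1 < p)%N ->
  sw p p.+1 (sw q q.+1 w) = sw q q.+1 (sw p p.+1 w).
Proof.
move=> h; apply/funext => k; rewrite /sw.
have [h1 h2 h3 h4] : [/\ (p == q) = false, (p == q.+1) = false, (p.+1 == q) = false
  & (p.+1 == q.+1) = false] by split; lia.
have [h1' h2' h3' h4'] : [/\ (q == p) = false, (q.+1 == p) = false, (q == p.+1) = false
  & (q.+1 == p.+1) = false] by split; lia.
rewrite h1 h2 h3 h4 h1' h2' h3' h4'.
case: (eqVneq k p) => [->|]; first by rewrite h1 h2.
by case: (eqVneq k p.+1) => [->|]; first by rewrite h3 h4.
Qed.

Lemma sw_at1 p q w : sw p q w p = w q.
Proof. by rewrite /sw eqxx. Qed.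

Lemma sw_at2 p q w : sw p q w q = w p.
Proof. by rewrite /sw eqxx; case: eqP => // ->. Qed.

Lemma sw_out p q w k : k != p -> k != q -> sw p q w k = w k.
Proof. by rewrite /sw => /negbTE -> /negbTE ->. Qed.

Lemma sw_jumpL p w : w p.+1 = w p.+2 -> sw p.+1 p.+2 (sw p p.+1 w) = sw p p.+2 w.
Proof.
move=> h; apply/funext => k; rewrite /sw.
by do ![case: eqP => ?]; subst; try lia; congruence.
Qed.

Lemma sw_jumpR p w : w p = w p.+1 -> sw p p.+1 (sw p.+1 p.+2 w) = sw p p.+2 w.
Proof.
move=> h; apply/funext => k; rewrite /sw.
by do ![case: eqP => ?]; subst; try lia; congruence.
Qed.

Lemma quot_pi_rel (A : pzRingType) (X : A -> A -> Prop) a b :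
  X a b -> quot_pi X a = quot_pi X b.
Proof. by move=> h; apply/quot_piP; rewrite -[_ - _]mul1r -[_ * _]mulr1; apply: ideal_of_rel. Qed.

(** * Modules generated by a vector satisfying the bihook relations *)

Section KlrAction.
Variables (F : fieldType) (e n : nat) (N : lmodType (klr F e n)).
Implicit Types (u : N) (i : res_seq e n).
Local Notation E := (@klr_e F e n).
Local Notation Y := (klr_y F e n).
Local Notation P := (klr_psi F e n).

Lemma klr_rel_act a b u : klr_rel a b ->
  quot_pi (@klr_rel F e n) a *: u = quot_pi (@klr_rel F e n) b *: u.
Proof. by move=> /quot_pi_rel ->. Qed.

Let pi2 (a b : klr_free F e n) u : quot_pi (@klr_rel F e n) (a * b) *: u =
  quot_pi (@klr_rel F e n) a *: (quot_pi (@klr_rel F e n) b *: u).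
Proof. by rewrite rmorphM -[LHS]scalerA. Qed.

Let piD (a b : klr_free F e n) u : quot_pi (@klr_rel F e n) (a + b) *: u =
  quot_pi (@klr_rel F e n) a *: u + quot_pi (@klr_rel F e n) b *: u.
Proof. by rewrite rmorphD scalerDl. Qed.

Let piB (a b : klr_free F e n) u : quot_pi (@klr_rel F e n) (a - b) *: u =
  quot_pi (@klr_rel F e n) a *: u - quot_pi (@klr_rel F e n) b *: u.
Proof. by rewrite rmorphB scalerBl. Qed.

Let pi0 u : quot_pi (@klr_rel F e n) 0 *: u = 0.
Proof. by rewrite rmorph0 scale0r. Qed.

Let pi1 u : quot_pi (@klr_rel F e n) 1 *: u = u.
Proof. by rewrite rmorph1 scale1r. Qed.

Let piif (b : bool) (a a' : klr_free F e n) u :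
  quot_pi (@klr_rel F e n) (if b then a else a') *: u =
  if b then quot_pi (@klr_rel F e n) a *: u else quot_pi (@klr_rel F e n) a' *: u.
Proof. by case: b. Qed.

Let pib (b : bool) u : quot_pi (@klr_rel F e n) b%:R *: u = if b then u else 0.
Proof. by case: b; rewrite (pi0, pi1). Qed.

Lemma klr_eeE i j u : E i *: (E j *: u) = if i == j then E i *: u else 0.
Proof. by have := klr_rel_act u (klr_ee F i j); rewrite pi2 piif pi0. Qed.

Lemma klr_psieE r i u : (0 < r < n)%N -> P r *: (E i *: u) = E (swap r i) *: (P r *: u).
Proof. by move=> hr; have := klr_rel_act u (klr_psie F i hr); rewrite [LHS]pi2 [RHS]pi2. Qed.

Lemma klr_psiyE r s u : (0 < r < n)%N -> (0 < s <= n)%N -> s != r -> s != r.+1 ->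
  P r *: (Y s *: u) = Y s *: (P r *: u).
Proof.
by move=> hr hs h h'; have := klr_rel_act u (klr_psiy F e hr hs h h'); rewrite [LHS]pi2 [RHS]pi2.
Qed.

Lemma klr_psipsiE r s u : (0 < r < n)%N -> (0 < s < n)%N -> (r.+1 < s)%N || (s.+1 < r)%N ->
  P r *: (P s *: u) = P s *: (P r *: u).
Proof.
by move=> hr hs h; have := klr_rel_act u (klr_psipsi F e hr hs h); rewrite [LHS]pi2 [RHS]pi2.
Qed.

Section Weight.
Variables (i : res_seq e n) (u : N).
Hypothesis ui : E i *: u = u.

Lemma klr_psi_ySE r : (0 < r < n)%N ->
  P r *: (Y r.+1 *: u) = Y r *: (P r *: u) + (if res i r == res i r.+1 then u else 0).
Proof.
move=> hr; have := klr_rel_act u (klr_psi_yS F i hr).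
by rewrite [LHS]pi2 [LHS]pi2 [RHS]pi2 ui piD pib [X in _ = X + _]pi2.
Qed.

Lemma klr_yS_psiE r : (0 < r < n)%N ->
  Y r.+1 *: (P r *: u) = P r *: (Y r *: u) + (if res i r == res i r.+1 then u else 0).
Proof.
move=> hr; have := klr_rel_act u (klr_yS_psi F i hr).
by rewrite [LHS]pi2 [LHS]pi2 [RHS]pi2 ui piD pib [X in _ = X + _]pi2.
Qed.

Lemma klr_psi2E r : (0 < r < n)%N ->
  P r *: (P r *: u) =
    if res i r == res i r.+1 then 0
    else if res i r.+1 == res i r + 1 then Y r.+1 *: u - Y r *: u
    else if res i r.+1 == res i r - 1 then Y r *: u - Y r.+1 *: u
    else u.
Proof.
move=> hr; have := klr_rel_act u (klr_psi2 F i hr).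
rewrite expr2 [LHS]pi2 [LHS]pi2 ui => ->.
case: ifP => _; first exact: pi0.
case: ifP => _; first by rewrite [LHS]pi2 ui piB.
by case: ifP => _; first by rewrite [LHS]pi2 ui piB.
Qed.

Lemma klr_braidE r : (0 < r)%N -> (r.+1 < n)%N ->
  P r *: (P r.+1 *: (P r *: u)) = P r.+1 *: (P r *: (P r.+1 *: u)) +
    (if (res i r.+2 == res i r) && (res i r.+1 == res i r + 1) then u
     else if (res i r.+2 == res i r) && (res i r.+1 == res i r - 1) then - u else 0).
Proof.
move=> hr hr'; have := klr_rel_act u (klr_braid F i hr hr').
rewrite [LHS]pi2 [LHS]pi2 [LHS]pi2 ui => ->.
case: ifP => _.
  by rewrite [LHS]pi2 ui piD pi1 [X in X + _]pi2 [X in X + _]pi2.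
case: ifP => _.
  by rewrite [LHS]pi2 ui piB pi1 [X in X - _]pi2 [X in X - _]pi2.
by rewrite [LHS]pi2 ui [LHS]pi2 [LHS]pi2 addr0.
Qed.

End Weight.
End KlrAction.

(** A jump at [r] needs an arm letter at [r]; one at [r-1] needs a leg letter at [r+1]. *)
Lemma act_psi_ascent (N : zmodType) z (v : word -> N) (w : word) r : w r -> ~~ w r.+1 -> act_psi z r v w = v (sw r r.+1 w).
Proof.
move=> wr wr1; rewrite /act_psi {2}/act_jump wr (negbTE wr1) /= if_same addr0.
have -> : act_jump r.-1 v w = 0; last by rewrite if_same addr0.
by rewrite /act_jump; case: r wr wr1 => [|r] /= wr /negbTE wr1; rewrite ?wr ?wr1 ?andbF.
Qed.

Definition leg_word (m : nat) : word := fun k => (k <= m)%N.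

Lemma nL_leg m k : nL (leg_word m) k = minn k m.+1.
Proof. by elim: k => [|k IH]; rewrite ?min0n //= IH /leg_word; lia. Qed.

Section Generated.
Variables (F : fieldType) (e n : nat) (kappa1 kappa2 : 'Z_e) (m : nat).
Hypotheses (e3 : (3 <= e)%N) (mn : (m <= n)%N).
Variables (N : lmodType (klr F e n)) (x : N).
Hypothesis x_rel : forall a b, bihook_rel kappa1 kappa2 m a b -> a *: x = b *: x.
Local Notation E := (@klr_e F e n).
Local Notation Y := (klr_y F e n).
Local Notation P := (klr_psi F e n).
Local Notation sp := (special kappa1 kappa2).
Local Notation resw := (resw n kappa1 kappa2).

Local Notation leg_word := (leg_word m).

(* [reach k w u]: the word [w] and the vector [u] are obtained from [leg_word] and
   [x] by the same [k] exchanges of a leg letter with the arm letter after it. *)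
Inductive reach : nat -> word -> N -> Prop :=
| reach0 : reach 0 leg_word x
| reachS k w u r : (0 < r < n)%N -> reach k w u -> w r -> ~~ w r.+1 ->
    reach k.+1 (sw r r.+1 w) (P r *: u).

Lemma reach_range k w u : reach k w u -> w 0%N /\ forall j, (n < j)%N -> ~~ w j.
Proof.
elim=> [|{}k {}w {}u r hr _ [w0 wn] wr wr1].
  by split=> // j hj; rewrite /leg_word -ltnNge (leq_ltn_trans mn).
split; first by rewrite sw_out //; lia.
by move=> j hj; rewrite sw_out ?wn //; lia.
Qed.

(** Any descent can be taken as the last exchange: two distinct descents of a word are at distance
    at least two, so the corresponding [psi] commute. *)
Lemma reach_descent k w u s : reach k w u -> ~~ w s -> w s.+1 ->
  exists k' u', [/\ k = k'.+1, reach k' (sw s s.+1 w) u' & u = P s *: u'].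
Proof.
move=> h; elim: h s => [|{}k {}w {}u r hr hw IH wr wr1] s hs hs1.
  by move: hs hs1; rewrite /leg_word; lia.
case: (eqVneq s r) => [->|sr]; first by exists k, u; rewrite swK.
have [sr1 rs1] : s != r.+1 /\ r != s.+1.
  split; apply/eqP => e1.
  - by move: hs; rewrite e1 sw_at2 wr.
  - by move: hs1; rewrite -e1 sw_at1 (negbTE wr1).
have far : (r.+1 < s)%N || (s.+1 < r)%N by lia.
rewrite sw_out // in hs; rewrite sw_out // in hs1; try lia.
have [k' [u' [ek hu' eu]]] := IH s hs hs1.
exists k, (P r *: u'); split=> //; last first.
  rewrite eu klr_psipsiE //.
  have [w0 wn] := reach_range hw.
  have : s != 0%N by apply: contraNneq hs => ->.
  have : ~~ (n < s.+1)%N by apply: contraL hs1 => /wn.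
  lia.
rewrite ek -sw_far //.
by apply: reachS => //; rewrite sw_out //; lia.
Qed.

(** Reduced expressions of a shuffle differ by commutations only, so the vector depends on the word
    alone. The induction peels the same descent off both derivations. *)
Lemma reach_fun k w u k' u' : reach k w u -> reach k' w u' -> u = u'.
Proof.
move=> h; elim: h k' u' => [|{}k {}w {}u r hr hw IH wr wr1] k' u' h'.
  case Hw : _ _ / h' => [//|k0 w0 u0 r hr _ wr wr1].
  have := congr1 (fun f => f r) Hw; have := congr1 (fun f => f r.+1) Hw.
  by rewrite sw_at1 sw_at2 (negbTE wr1) wr /leg_word; lia.
have [||k0 [u0 [_ h0 ->]]] := reach_descent (s := r) h'; rewrite ?sw_at1 ?sw_at2 //.
by rewrite swK in h0; rewrite (IH _ _ h0).
Qed.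

(** In a bihook Specht module this is the standard basis vector of [w]. It is selected by classical
    choice, with value 0 at words that are not reached. *)
Definition vec (w : word) : N :=
  if pselect (exists u, exists k, reach k w u) is left h then projT1 (cid h) else 0.

Lemma reach_vec k w u : reach k w u -> vec w = u.
Proof.
move=> h; rewrite /vec; case: pselect => [h'|[]]; last by exists u, k.
by case: (cid h') => u' [k' h''] /=; apply: reach_fun h'' h.
Qed.

Definition reachable k w := exists u, reach k w u.

Lemma reachable_range k w : reachable k w -> w 0%N /\ forall j, (n < j)%N -> ~~ w j.
Proof. by case=> u /reach_range. Qed.

Lemma reachable0 : reachable 0 leg_word.
Proof. by exists x; apply: reach0. Qed.

Lemma vec0 : vec leg_word = x.
Proof. exact: reach_vec reach0. Qed.

Lemma reachable_ascent k w r : (0 < r < n)%N -> reachable k w -> w r -> ~~ w r.+1 ->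
  reachable k.+1 (sw r r.+1 w) /\ P r *: vec w = vec (sw r r.+1 w).
Proof.
move=> hr [u hu] wr wr1; have h := reachS hr hu wr wr1.
by split; [exists (P r *: u) | rewrite (reach_vec h) (reach_vec hu)].
Qed.

Lemma reachable_descent k w s : reachable k w -> ~~ w s -> w s.+1 ->
  exists k', [/\ k = k'.+1, reachable k' (sw s s.+1 w), (0 < s < n)%N
    & vec w = P s *: vec (sw s s.+1 w)].
Proof.
move=> [u hu] ws ws1; have [k' [u' [ek hu' eu]]] := reach_descent hu ws ws1.
have [w0 wn] := reach_range hu.
exists k'; split=> //; [by exists u'| |by rewrite (reach_vec hu) (reach_vec hu')].
have : s != 0%N by apply: contraNneq ws => ->.
have : ~~ (n < s.+1)%N by apply: contraL ws1 => /wn.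
lia.
Qed.

Lemma reachable_case k w : reachable k w ->
  (k = 0%N /\ w = leg_word) \/ exists s, ~~ w s /\ w s.+1.
Proof.
by case=> u [|{}k {}w {}u r hr _ wr wr1]; [left | right; exists r; rewrite sw_at1 sw_at2].
Qed.

Lemma resw_leg : res_bihook n kappa1 kappa2 m = resw leg_word.
Proof.
apply: res_inj => r hr; rewrite res_resw //.
rewrite /res_bihook (res_tuple (fun k => if (k.-1 < m)%N then kappa2 - k.-1%:R
  else kappa1 + (k.-1 - m)%:R)) //.
case: r hr => // r hr; rewrite /rs nL_leg /leg_word /=; case: (ltnP r m) => h.
  by rewrite (minn_idPl _) ?ltnS 1?ltnW // -natr1; ring.
by rewrite (minn_idPr _) ?ltnS // natrB // -!natr1; ring.
Qed.

Lemma vec_weight k w : reachable k w -> E (resw w) *: vec w = vec w.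
Proof.
case=> u hu; rewrite (reach_vec hu); elim: hu => [|{}k {}w {}u r hr hw IH wr wr1].
  by have := x_rel (@bihook_e F e n kappa1 kappa2 m); rewrite scale1r resw_leg.
by rewrite resw_sw ?wr ?(negbTE wr1) // -klr_psieE // IH.
Qed.

(** The exchange undoes two adjacent descents, in an order dictated by the middle letter, so it
    removes exactly two inversions. *)
Lemma reachable_jump k w p : reachable k w -> ~~ w p -> w p.+2 ->
  exists k', k = k'.+2 /\ reachable k' (sw p p.+2 w).
Proof.
move=> hw wp wp2; case wp1: (w p.+1).
  have [k1 [-> h1 _ _]] := reachable_descent hw wp wp1.
  have [||k2 [-> h2 _ _]] := reachable_descent (s := p.+1) h1.
  - by rewrite sw_at2.
  - by rewrite sw_out //; lia.
  by exists k2; rewrite -sw_jumpL // wp1 wp2.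
have [|k1 [-> h1 _ _]] := reachable_descent hw _ wp2; first by rewrite wp1.
have [||k2 [-> h2 _ _]] := reachable_descent (s := p) h1.
- by rewrite sw_out //; lia.
- by rewrite sw_at1.
by exists k2; rewrite -sw_jumpR // wp1 (negbTE wp).
Qed.

Lemma act_y_congr k w f g r : reachable k w ->
  (forall j u, (j < k)%N -> reachable j u -> f u = g u :> N) ->
  act_y sp r f w = act_y sp r g w.
Proof.
move=> hw fg; have L p : act_low sp p f w = act_low sp p g w.
  rewrite /act_low; case: ifP => // /and3P[_ h1 h2].
  by have [k' [ek h _ _]] := reachable_descent hw h1 h2; apply: (fg k') => //; rewrite ek.
by rewrite /act_y !L.
Qed.

(** Every word produced by [psi_r] has fewer inversions, except at a leg-arm pair, where there is
    one more. The induction on inversions rests on this count. *)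
Lemma act_psi_congr k w f g r : reachable k w -> (0 < r < n)%N ->
  (forall j u, (j < k)%N || [&& w r, ~~ w r.+1 & (j <= k.+1)%N] ->
    reachable j u -> f u = g u :> N) ->
  act_psi sp r f w = act_psi sp r g w.
Proof.
move=> hw hr fg; have J p : act_jump p f w = act_jump p g w.
  rewrite /act_jump; case: ifP => // /andP[h1 h2].
  have [k' [ek h]] := reachable_jump hw h1 h2.
  by rewrite (fg k') // ek; apply/orP; left; lia.
rewrite /act_psi !J; congr (_ + _ + _); case: ifP => // /andP[h _].
case wr: (w r); move: h; rewrite wr; case wr1: (w r.+1) => // _.
  have [h _] := reachable_ascent hr hw wr (negbT wr1).
  by apply: (fg k.+1) => //; rewrite wr wr1 leqnn orbT.
have [k' [ek h _ _]] := reachable_descent hw (negbT wr) wr1.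
by apply: (fg k') => //; rewrite ek leqnn.
Qed.

Section Step.
Variables (k : nat) (w : word) (s : nat).
Hypotheses (hw : reachable k w) (hs : (0 < s < n)%N).
Hypotheses (ws : w s) (ws1 : ~~ w s.+1).
Hypothesis IHy : forall j u, (j <= k)%N -> reachable j u ->
  forall r, (0 < r <= n)%N -> Y r *: vec u = act_y sp r vec u.
Hypothesis IHpsi : forall j u, (j <= k)%N -> reachable j u ->
  forall r, (0 < r < n)%N -> P r *: vec u = act_psi sp r vec u.

Let s0 : (0 < s)%N. Proof. by case/andP: hs. Qed.
Let sS : (0 < s.+1 <= n)%N. Proof. lia. Qed.
Let sn : (0 < s <= n)%N. Proof. lia. Qed.
Let sp_sparse : sparse sp. Proof. exact: sparse_special (two_neq0_Zp e3). Qed.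
Let w1 := sw s s.+1 w.

Let vec_w1 : vec w1 = P s *: vec w.
Proof. by have [_ ->] := reachable_ascent hs hw ws ws1. Qed.

(** Evaluation at [w1] is an operator evaluated at [w], for every [v]. Statements about [w1] thereby
    become composites at [w], to which the operator relations apply. *)
Let act_w1 (v : word -> N) : act_psi sp s v w = v w1.
Proof. exact: act_psi_ascent. Qed.

Let psi_y t r : (0 < t < n)%N -> (0 < r <= n)%N ->
  P t *: act_y sp r vec w = act_y sp r (act_psi sp t vec) w.
Proof.
move=> ht hr; rewrite [LHS]y_scale; apply: (act_y_congr _ hw) => j u hj hu.
exact: IHpsi (ltnW hj) hu _ ht.
Qed.

Lemma step_y r : (0 < r <= n)%N -> Y r *: vec w1 = act_y sp r vec w1.
Proof.
move=> hr; have r0 : (0 < r)%N by case/andP: hr.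
rewrite vec_w1 -act_w1.
case: (eqVneq r s) => [->|rs].
  (* [y_s psi_s] is read off from [psi_s y_(s+1)]; the delta terms in the module and among the
     operators agree and cancel. *)
  have := klr_psi_ySE (vec_weight hw) hs.
  rewrite !res_resw // rs_eq ?two_neq0_Zp // (IHy _ hw sS) // psi_y //.
  by rewrite act_y_psi // => /addIr.
case: (eqVneq r s.+1) => [->|rs1].
  rewrite (klr_yS_psiE (vec_weight hw)) // !res_resw // rs_eq ?two_neq0_Zp //.
  by rewrite (IHy _ hw sn) // psi_y // act_psi_y.
by rewrite -klr_psiyE // (IHy _ hw hr) // psi_y // -act_psi_y_far.
Qed.

Lemma step_psi_descent : P s *: vec w1 = act_psi sp s vec w1.
Proof.
rewrite vec_w1 -act_w1 act_psi_sqr // (klr_psi2E (vec_weight hw)) // !res_resw //.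
rewrite rs_eq ?two_neq0_Zp // rs_succ ?two_neq0_Zp // rs_pred ?two_neq0_Zp //.
by rewrite (IHy _ hw sn) // (IHy _ hw sS).
Qed.

Lemma step_psi_far r : (0 < r < n)%N -> (r.+1 < s)%N || (s.+1 < r)%N -> w r = w r.+1 ->
  P r *: vec w1 = act_psi sp r vec w1.
Proof.
move=> hr far wr; have r0 : (0 < r)%N by case/andP: hr.
rewrite vec_w1 -act_w1 klr_psipsiE // (IHpsi _ hw hr) // [LHS]psi_scale -act_psi_far //.
apply: (act_psi_congr hw hr) => j u; rewrite wr andbA andbN orbF => hj hu.
exact: IHpsi (ltnW hj) hu _ hs.
Qed.

End Step.

(** Equal letters at [b] make [psi_b] lower the inversions strictly, and [psi_a] raises them by at
    most one; so the hypothesis up to [k] still covers the last [psi_b]. *)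
Lemma psi_triple k w a b : reachable k w -> (0 < a < n)%N -> (0 < b < n)%N ->
  w b = w b.+1 ->
  (forall j u, (j <= k)%N -> reachable j u ->
    forall r, (0 < r < n)%N -> P r *: vec u = act_psi sp r vec u) ->
  P b *: (P a *: (P b *: vec w)) = act_psi sp b (act_psi sp a (act_psi sp b vec)) w.
Proof.
move=> hw ha hb wb IH; rewrite (IH _ _ (leqnn k) hw _ hb) [X in _ *: X]psi_scale [LHS]psi_scale.
have low j : (j < k)%N || [&& w b, ~~ w b.+1 & (j <= k.+1)%N] -> (j < k)%N.
  by rewrite wb andbA andbN orbF.
apply: (act_psi_congr hw hb) => j u /low hj hu; rewrite (IH _ _ (ltnW hj) hu _ ha) [LHS]psi_scale.
apply: (act_psi_congr hu ha) => j' u' hj' hu'; apply: IH hu' _ hb.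
by case/orP: hj' => [h|/and3P[_ _ h]]; lia.
Qed.

Lemma leg_action r : ((0 < r <= n)%N -> Y r *: vec leg_word = act_y sp r vec leg_word) /\
  ((0 < r < n)%N -> P r *: vec leg_word = act_psi sp r vec leg_word).
Proof.
have J p : act_jump p vec leg_word = 0 by rewrite /act_jump /leg_word ifF //; lia.
have L p : act_low sp p vec leg_word = 0 by rewrite /act_low /leg_word ifF //; lia.
split=> hr.
  by rewrite vec0 (x_rel (bihook_y _ _ _ _ hr)) scale0r /act_y !L subr0.
case: (eqVneq r m) => [rm|rm]; last first.
  rewrite vec0 (x_rel (bihook_psi _ _ _ hr rm)) scale0r /act_psi !J !if_same ifF ?addr0 //.
  by rewrite /leg_word; lia.
have [h1 h2] : leg_word r /\ ~~ leg_word r.+1 by rewrite /leg_word; lia.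
by have [_ ->] := reachable_ascent hr reachable0 h1 h2; rewrite act_psi_ascent.
Qed.

Section Braid.
Variables (k : nat) (w : word) (r : nat).
Hypotheses (hw : reachable k w) (r0 : (0 < r)%N) (rn : (r.+1 < n)%N).
Hypothesis IHpsi : forall j u, (j <= k)%N -> reachable j u ->
  forall r, (0 < r < n)%N -> P r *: vec u = act_psi sp r vec u.

Let hr : (0 < r < n)%N. Proof. lia. Qed.
Let hr1 : (0 < r.+1 < n)%N. Proof. lia. Qed.
Let sp_sparse : sparse sp. Proof. exact: sparse_special (two_neq0_Zp e3). Qed.

Let braid : P r *: (P r.+1 *: (P r *: vec w)) =
  P r.+1 *: (P r *: (P r.+1 *: vec w)) + braid_defect sp r vec w.
Proof.
have [n1 n2 n3] : [/\ 0 < r <= n, 0 < r.+1 <= n & 0 < r.+2 <= n]%N by split; lia.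
rewrite (klr_braidE (vec_weight hw)) // !res_resw // braid_defectE ?two_neq0_Zp //.
Qed.

(** The resulting word reads arm, arm, leg from [r] on. Acting on it by [psi_r] means applying a
    braid product to [w], which is traded for the other braid product and the defect both in the
    module and among operators. *)
Lemma step_psi_RRL : w r -> ~~ w r.+1 -> ~~ w r.+2 ->
  P r *: vec (sw r.+1 r.+2 (sw r r.+1 w)) = act_psi sp r vec (sw r.+1 r.+2 (sw r r.+1 w)).
Proof.
move=> w0 w1 w2; have [h1 e1] := reachable_ascent hr hw w0 w1.
have g1 : sw r r.+1 w r.+1 by rewrite sw_at2.
have g2 : ~~ sw r r.+1 w r.+2 by rewrite sw_out //; lia.
have [_ <-] := reachable_ascent hr1 h1 g1 g2.
rewrite -(act_psi_ascent sp (act_psi sp r vec) g1 g2) -(act_psi_ascent sp (act_psi sp r.+1 (act_psi sp r vec)) w0 w1).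
rewrite act_braid // -e1 braid (psi_triple hw hr hr1 _ IHpsi) //.
by rewrite (negbTE w1) (negbTE w2).
Qed.

Lemma step_psi_RLL : w r -> w r.+1 -> ~~ w r.+2 ->
  P r.+1 *: vec (sw r r.+1 (sw r.+1 r.+2 w)) = act_psi sp r.+1 vec (sw r r.+1 (sw r.+1 r.+2 w)).
Proof.
move=> w0 w1 w2; have [h1 e1] := reachable_ascent hr1 hw w1 w2.
have g1 : sw r.+1 r.+2 w r by rewrite sw_out //; lia.
have g2 : ~~ sw r.+1 r.+2 w r.+1 by rewrite sw_at1.
have [_ <-] := reachable_ascent hr h1 g1 g2.
rewrite -(act_psi_ascent sp (act_psi sp r.+1 vec) g1 g2) -(act_psi_ascent sp (act_psi sp r (act_psi sp r.+1 vec)) w1 w2) -e1.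
(* Here the braid relation is used in the opposite direction, so the defect is first added to both
   sides. *)
apply: (addIr (braid_defect sp r vec w)).
rewrite -act_braid // -braid (psi_triple hw hr1 hr _ IHpsi) //.
by rewrite w0 w1.
Qed.

End Braid.

(* Induction on [k]: a descent of [w] writes [vec w] as [psi_s] of a vector of
   smaller depth, and the relation moving the generator past [psi_s] holds in the
   module of words as well. *)
Lemma vec_action k w : reachable k w ->
  (forall r, (0 < r <= n)%N -> Y r *: vec w = act_y sp r vec w) /\
  (forall r, (0 < r < n)%N -> P r *: vec w = act_psi sp r vec w).
Proof.
elim/ltn_ind: k w => k IH w hw.
have IHy k' (hk : (k' < k)%N) j u (hj : (j <= k')%N) (hu : reachable j u) :
  forall r, (0 < r <= n)%N -> Y r *: vec u = act_y sp r vec u.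
  by have [] := IH j (leq_ltn_trans hj hk) u hu.
have IHpsi k' (hk : (k' < k)%N) j u (hj : (j <= k')%N) (hu : reachable j u) :
  forall r, (0 < r < n)%N -> P r *: vec u = act_psi sp r vec u.
  by have [] := IH j (leq_ltn_trans hj hk) u hu.
case: (reachable_case hw) => [[_ ->]|[s [ws ws1]]].
  by split=> r hr; have [h1 h2] := leg_action r; [apply: h1 | apply: h2].
have [k1 [ek h1 hs _]] := reachable_descent hw ws ws1.
have hk1 : (k1 < k)%N by rewrite ek.
have w1s : sw s s.+1 w s by rewrite sw_at1.
have w1s1 : ~~ sw s s.+1 w s.+1 by rewrite sw_at2.
have out j : j != s -> j != s.+1 -> sw s s.+1 w j = w j by apply: sw_out.
split=> r hr.
  by have := step_y h1 hs w1s w1s1 (IHy _ hk1) (IHpsi _ hk1) hr; rewrite swK.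
case wr: (w r); case wr1: (w r.+1).
- case: (boolP ((r.+1 < s)%N || (s.+1 < r)%N)) => far.
    have := step_psi_far h1 hs w1s w1s1 (IHpsi _ hk1) hr far.
    by rewrite swK !out; [apply; rewrite wr wr1|lia..].
  have er : r = s.+1.
    have : s <> r by move=> e1; rewrite e1 wr in ws.
    have : s <> r.+1 by move=> e1; rewrite e1 wr1 in ws.
    by lia.
  subst r; have g2 : sw s s.+1 w s.+2 by rewrite out //; lia.
  (* The letters from [s] on are arm, leg, leg; a second descent writes the vector as
     [psi_s psi_(s+1)] of the word with leg, leg, arm there. *)
  have [k2 [ek1 h2 hs1 _]] := reachable_descent h1 w1s1 g2.
  have hk2 : (k2 < k)%N by rewrite ek ek1; lia.
  have [s0 sn] : (0 < s)%N /\ (s.+1 < n)%N by lia.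
  have := step_psi_RLL h2 s0 sn (IHpsi _ hk2).
  rewrite sw_at1 sw_at2 [sw _ _ _ s]sw_out ?sw_at1 ?swK; [|lia..].
  by apply.
- have [_ ->] := reachable_ascent hr hw wr (negbT wr1).
  by rewrite act_psi_ascent // wr1.
- have [k2 [ek2 h2 _ _]] := reachable_descent hw (negbT wr) wr1.
  have hk2 : (k2 < k)%N by rewrite ek2.
  have := step_psi_descent h2 hr _ _ (IHy _ hk2).
  by rewrite sw_at1 sw_at2 swK; apply=> //; rewrite wr.
- case: (boolP ((r.+1 < s)%N || (s.+1 < r)%N)) => far.
    have := step_psi_far h1 hs w1s w1s1 (IHpsi _ hk1) hr far.
    by rewrite swK !out; [apply; rewrite wr wr1|lia..].
  have er : s = r.+1.
    have : s.+1 <> r by move=> e1; rewrite e1 wr in ws1.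
    have : s <> r by move=> e1; rewrite e1 wr1 in ws1.
    by lia.
  subst s; have g2 : ~~ sw r.+1 r.+2 w r by rewrite out ?wr //; lia.
  have [k2 [ek1 h2 hs1 _]] := reachable_descent h1 g2 w1s.
  have hk2 : (k2 < k)%N by rewrite ek ek1; lia.
  have [r0 rn] : (0 < r)%N /\ (r.+1 < n)%N by lia.
  have := step_psi_RRL h2 r0 rn (IHpsi _ hk2).
  rewrite sw_at1 sw_at2 [sw _ _ _ r.+2]sw_out ?sw_at2 ?swK; [|lia..].
  by apply=> //; rewrite wr1.
Qed.

End Generated.

(** * Presented modules and the cyclotomic relations *)

Section PresentedHom.
Variables (A : pzRingType) (X : A -> A -> Prop) (N : lmodType A) (w : N).
Hypothesis hw : forall a b, X a b -> a *: w = b *: w.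

Definition pres_map (u : pres_mod X) : N := pres_repr u *: w.

Lemma pres_mapE a : pres_map (pres_pi X a) = a *: w.
Proof.
have : left_ideal_of X (pres_repr (pres_pi X a) - a) by apply/pres_piP; rewrite pres_reprK.
rewrite /pres_map -[X in X *: w = _](subrK a); move: (_ - a) => d hd.
suff -> : (d + a) *: w = d *: w + a *: w.
  suff -> : d *: w = 0 by rewrite add0r.
  elim: hd => [c x y xy||u v _ IHu _ IHv].
  - by rewrite -[LHS]scalerA scalerBl (hw xy) subrr scaler0.
  - by rewrite scale0r.
  - by rewrite scalerDl IHu IHv addr0.
by rewrite scalerDl.
Qed.

Lemma pres_map_linear : linear pres_map.
Proof.
move=> a u v; rewrite -(pres_reprK u) -(pres_reprK v).
have -> : a *: pres_pi X (pres_repr u) + pres_pi X (pres_repr v) =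
    pres_pi X (a * pres_repr u + pres_repr v).
  by rewrite pres_piD -pres_scaleE.
by rewrite !pres_mapE scalerDl -[X in X + _]scalerA.
Qed.

Lemma pres_hom : exists f : {linear pres_mod X -> N}, f (pres_gen X) = w.
Proof.
pose f := HB.pack_for {linear pres_mod X -> N} pres_map
  (GRing.isLinear.Build A (pres_mod X) N *:%R pres_map pres_map_linear).
by exists f; rewrite /f /= pres_mapE scale1r.
Qed.

End PresentedHom.

Lemma pres_gen_span (A : pzRingType) (X : A -> A -> Prop) (u : pres_mod X) :
  exists a, u = a *: pres_gen X.
Proof.
exists (pres_repr u); rewrite -[LHS]pres_reprK -[RHS]/(pres_scale _ _) /pres_gen.
by rewrite pres_scaleE mulr1.
Qed.

Lemma pres_gen_rel (A : pzRingType) (X : A -> A -> Prop) a b :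
  X a b -> a *: pres_gen X = b *: pres_gen X.
Proof.
move=> ab; rewrite -[LHS]/(pres_scale _ _) -[RHS]/(pres_scale _ _) !pres_scaleE !mulr1.
by apply/pres_piP; rewrite -[_ - _]mul1r; apply: left_ideal_of_rel.
Qed.

Section CyclotomicHom.
Variables (F : fieldType) (e n : nat) (kappa1 kappa2 : 'Z_e).
Local Notation cyc := (@cyc_rel F e n kappa1 kappa2).

Lemma nonzero_cyc_homP (M N : lmodType (klr F e n)) (f : {linear M -> N}) x :
  satisfies cyc M -> satisfies cyc N -> f x != 0 ->
  nonzero_cyc_hom kappa1 kappa2 x (f x).
Proof.
move=> hM hN fx; exists hM, hN.
have flin : linear (f : descend hM -> descend hN).
  move=> u a b; rewrite -[u *: a]/(descend_scale u a) /descend_scale.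
  by rewrite linearP.
pose g := HB.pack_for {linear descend hM -> descend hN} (f : descend hM -> descend hN)
  (GRing.isLinear.Build _ _ _ _ (f : descend hM -> descend hN) flin).
by exists g; split=> //; exists x.
Qed.

End CyclotomicHom.

(** * The span of the words is a submodule *)

Section Span.
Variables (F : fieldType) (e n : nat) (kappa1 kappa2 : 'Z_e) (m : nat).
Hypotheses (e3 : (3 <= e)%N) (mn : (m <= n)%N).
Variables (N : lmodType (klr F e n)) (x : N).
Hypothesis x_rel : forall a b, bihook_rel kappa1 kappa2 m a b -> a *: x = b *: x.
Local Notation E := (@klr_e F e n).
Local Notation Y := (klr_y F e n).
Local Notation P := (klr_psi F e n).
Local Notation sp := (special kappa1 kappa2).
Local Notation reachable := (reachable m x).
Local Notation vec := (vec m x).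
Local Notation pi := (quot_pi (@klr_rel F e n)).

Inductive span : N -> Prop :=
| span_vec k w : reachable k w -> span (vec w)
| span0 : span 0
| spanD u v : span u -> span v -> span (u + v)
| spanN u : span u -> span (- u)
| spanZ (c : F) u : span u -> span (pi c%:A *: u).

Let piM a b : pi (a * b) = pi a * pi b. Proof. exact: rmorphM. Qed.

Let free_scalar_comm (c : F) (a : klr_free F e n) : c%:A * a = a * c%:A.
Proof. by rewrite -scalerAl mul1r malg_scalerAr mulr1. Qed.

Lemma scalar_comm (c : F) (a : klr F e n) : pi c%:A * a = a * pi c%:A.
Proof.
move: (quot_reprK a) => <-; move: (quot_repr a) => {}a.
by rewrite -[LHS]piM -[RHS]piM; exact: (congr1 pi (free_scalar_comm c a)).
Qed.

Lemma span_y k w r : reachable k w -> (0 < r <= n)%N -> span (Y r *: vec w).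
Proof.
move=> hw hr; have [hy _] := vec_action e3 mn x_rel hw; rewrite hy //.
have L p : span (act_low sp p vec w).
  rewrite /act_low; case: ifP => [/and3P[_ h1 h2]|_]; last exact: span0.
  by have [k' [_ h _ _]] := reachable_descent e3 mn hw h1 h2; apply: span_vec h.
exact/spanD/spanN/L/L.
Qed.

Lemma span_psi k w r : reachable k w -> (0 < r < n)%N -> span (P r *: vec w).
Proof.
move=> hw hr; have [_ hp] := vec_action e3 mn x_rel hw; rewrite hp //.
have J p : span (act_jump p vec w).
  rewrite /act_jump; case: ifP => [/andP[h1 h2]|_]; last exact: span0.
  have [k' [_ h]] := reachable_jump e3 mn hw h1 h2.
  by case: ifP => _; [|apply: spanN]; apply: span_vec h.
rewrite /act_psi; apply: spanD; [apply: spanD|].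
- case: ifP => [/andP[h _]|_]; last exact: span0.
  case wr: (w r); move: h; rewrite wr; case wr1: (w r.+1) => // _.
    have [h _] := reachable_ascent e3 mn hr hw wr (negbT wr1).
    exact: span_vec h.
  have [k' [_ h _ _]] := reachable_descent e3 mn hw (negbT wr) wr1.
  exact: span_vec h.
- by case: ifP => _; [apply: J | apply: span0].
- by case: ifP => _; [apply: J | apply: span0].
Qed.

Lemma span_e k w i : reachable k w -> span (E i *: vec w).
Proof.
move=> hw; rewrite -(vec_weight e3 mn x_rel hw) klr_eeE; case: eqP => [->|_]; last exact: span0.
by rewrite (vec_weight e3 mn x_rel hw); apply: span_vec hw.
Qed.

Lemma span_gen g u : span u -> span (pi (free_gen F g) *: u).
Proof.
elim=> [k w hw||u1 u2 _ h1 _ h2|u1 _ h1|c u1 _ h1].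
- case: g => [[i|[r hr]]|[r hr]].
  + exact: span_e hw.
  + by have := span_y hw hr; rewrite /klr_y /free_y insubT.
  + by have := span_psi hw hr; rewrite /klr_psi /free_psi insubT.
- by rewrite scaler0; apply: span0.
- by rewrite scalerDr; apply: spanD.
- by rewrite scalerN; apply: spanN.
- by rewrite [_ *: _]scalerA -scalar_comm -[X in span X]scalerA; apply: spanZ.
Qed.

Lemma span_scale a u : span u -> span (a *: u).
Proof.
move=> hu; rewrite -(quot_reprK a); move: (quot_repr a) => {}a.
rewrite (malg_expand a) raddf_sum scaler_suml /=.
apply: big_ind => [|u1 u2|k _]; [exact: span0|exact: spanD|].
have -> : a@_k *: (<< k >> : klr_free F e n) = (a@_k)%:A * << k >>.
  by rewrite -scalerAl mul1r.
rewrite piM -[X in span X]scalerA; apply: spanZ.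
rewrite -[k]fmK; elim: (k : seq _) => [|g s IH].
  have -> : pi << FMonom [::] >> = 1 by rewrite -fmoneE; apply: rmorph1.
  by rewrite scale1r.
have -> : << FMonom (g :: s) >> = free_gen F g * << FMonom s >> :> klr_free F e n.
  rewrite [RHS]malgM_def fgmulUU mulr1; congr << _ >>.
  by rewrite fmuE [RHS]fmmulE.
by rewrite piM -[X in span X]scalerA; apply: span_gen.
Qed.

(** [d] commutes with the scalars from [F] but not with the algebra, so its vanishing is tested on
    all words and not on the generator alone. *)
Lemma span_kill (d : klr F e n) : (forall u : N, exists a, u = a *: x) ->
  (forall k w, reachable k w -> d *: vec w = 0) -> forall u : N, d *: u = 0.
Proof.
move=> gen h u; have [a ->] := gen u.
have : span (a *: x) by apply: span_scale; rewrite -(vec0 e3 mn x); apply: span_vec (reachable0 _ _).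
elim=> [k w /h //||u1 u2 _ h1 _ h2|u1 _ h1|c u1 _ h1].
- by rewrite scaler0.
- by rewrite scalerDr h1 h2 addr0.
- by rewrite scalerN h1 oppr0.
- by rewrite [LHS]scalerA -scalar_comm -[LHS]scalerA h1 scaler0.
Qed.

End Span.

Section BihookModule.
Variables (F : fieldType) (e n : nat) (kappa1 kappa2 : 'Z_e) (m : nat).
Hypotheses (e3 : (3 <= e)%N) (mn : (m <= n)%N).
Variables (N : lmodType (klr F e n)) (x : N).
Hypothesis x_rel : forall a b, bihook_rel kappa1 kappa2 m a b -> a *: x = b *: x.
Local Notation E := (@klr_e F e n).
Local Notation Y := (klr_y F e n).
Local Notation P := (klr_psi F e n).
Local Notation sp := (special kappa1 kappa2).
Local Notation reachable := (reachable m x).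
Local Notation vec := (vec m x).
Local Notation resw := (resw n kappa1 kappa2).

Lemma vec_y k w r : reachable k w -> (0 < r <= n)%N -> Y r *: vec w = act_y sp r vec w.
Proof. by move=> hw hr; have [h _] := vec_action e3 mn x_rel hw; apply: h. Qed.

Lemma vec_psi k w r : reachable k w -> (0 < r < n)%N -> P r *: vec w = act_psi sp r vec w.
Proof. by move=> hw hr; have [_ h] := vec_action e3 mn x_rel hw; apply: h. Qed.

Lemma reachable_head k w : reachable k w -> w 0%N.
Proof. by move=> hw; have [] := reachable_range e3 mn hw. Qed.

Lemma reachable_tail k w j : reachable k w -> (n < j)%N -> w j = false.
Proof. by move=> hw hj; have [_ h] := reachable_range e3 mn hw; apply/negbTE/h. Qed.

Lemma vec_y1 k w : (0 < n)%N -> reachable k w -> Y 1 *: vec w = - act_low sp 1 vec w.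
Proof.
move=> n0 hw; rewrite (vec_y hw) ?n0 // /act_y {1}/act_low (reachable_head hw) andbF.
by rewrite sub0r.
Qed.

Lemma expr_scale (a : klr F e n) c u : a *: u = 0 :> N -> (0 < c)%N -> a ^+ c *: u = 0.
Proof. by case: c => // c au _; rewrite exprSr -[LHS]scalerA au scaler0. Qed.

Lemma res_head k w : (0 < n)%N -> reachable k w ->
  res (resw w) 1 = if w 1%N then kappa2 else kappa1.
Proof.
move=> n0 hw; rewrite res_resw // /rs /= (reachable_head hw) addn0.
by case: (w 1%N) => /=; ring.
Qed.

(** The first letter has residue [kappa1] or [kappa2], and the padding leg letter reduces [y_1] to
    an exchange at position 1, special only if [kappa1 = kappa2]. In that case the exponent is 2,
    and the exchanged word begins with a leg letter, which a second [y_1] kills. *)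
Lemma bihook_cyc : (0 < n)%N -> (forall u : N, exists a, u = a *: x) ->
  satisfies (@cyc_rel F e n kappa1 kappa2) N.
Proof.
move=> n0 gen a b [i] u; rewrite scale0r; move: u; apply: (span_kill e3 mn x_rel) => // k w hw.
rewrite -[LHS]scalerA -(vec_weight e3 mn x_rel hw) klr_eeE.
case: eqP => [->|_]; last by rewrite scaler0.
rewrite (vec_weight e3 mn x_rel hw) /cyc_mult (res_head n0 hw).
have y1 : kappa1 != kappa2 -> Y 1 *: vec w = 0.
  move=> h; rewrite (vec_y1 n0 hw) /act_low ifF ?oppr0 // /special.
  rewrite subrK subr_eq0 (negbTE h) //.
case: (eqVneq kappa1 kappa2) => [ek|nk]; last first.
  apply: expr_scale; first exact: y1.
  by case: (w 1%N); rewrite eqxx ?addn1 ?add1n.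
rewrite ek if_same eqxx expr2 -[LHS]scalerA (vec_y1 n0 hw) scalerN.
rewrite /act_low; case: ifP => [/and3P[_ h1 h2]|_]; last by rewrite scaler0 oppr0.
have [k' [_ h' _ _]] := reachable_descent e3 mn hw h1 h2.
by rewrite (vec_y1 n0 h') /act_low sw_at1 h2 andbF !oppr0.
Qed.

Lemma reachable_count k w : reachable k w -> nL w n.+1 = m.+1.
Proof.
case=> u; elim=> [|{}k {}w {}u r hr _ IH _ _]; first by rewrite nL_leg (minn_idPr _).
by rewrite nL_out //; lia.
Qed.

Lemma move_down k w j a : reachable k w -> (0 < j)%N -> (j <= a <= n)%N -> w j ->
  (forall t, (j < t <= a)%N -> ~~ w t) ->
  (exists k', reachable k' (sw j a w)) /\ psi_down F e n a j *: vec w = vec (sw j a w).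
Proof.
move=> hw j0 /andP[ja an] wj; elim: a ja an => [|a IH] ja an wt; first by lia.
case: (eqVneq j a.+1) => [->|ja1].
  have -> : sw a.+1 a.+1 w = w by apply/funext => t; rewrite /sw; case: eqP => // ->.
  split; first by exists k.
  by rewrite /psi_down /index_iota subnn /= big_nil scale1r.
have ja' : (j <= a)%N by lia.
have [||[k' h'] e'] := IH ja'; [lia|by move=> t ht; apply: wt; lia|].
have g1 : sw j a w a by rewrite sw_at2.
have g2 : ~~ sw j a w a.+1 by rewrite sw_out; [apply: wt; lia|lia..].
have [|h'' e''] := reachable_ascent e3 mn _ h' g1 g2; first by lia.
have es : sw a a.+1 (sw j a w) = sw j a.+1 w.
  have wa1 := negbTE (wt a.+1 ltac:(lia)).
  apply/funext => t; rewrite /sw; case: (eqVneq j a) => [eja|nja].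
    by subst a; do ![case: eqP => ?]; subst; try lia; congruence.
  have wa := negbTE (wt a ltac:(lia)).
  by do ![case: eqP => ?]; subst; try lia; congruence.
rewrite -es; split; first by exists k'.+1.
rewrite -e'' -e' /psi_down /index_iota subSn // -addn1 iotaD rev_cat big_cat big_seq1 /=.
by rewrite subnKC // -[LHS]scalerA.
Qed.

(* If the letters [i], ..., [j] are leg letters and [j+1] is an arm letter, this moves
   the arm letter to position [i]. *)
Definition hole i j (w : word) : word :=
  fun k => if (i <= k <= j.+1)%N then k != i else w k.

Lemma move_up k w i j : reachable k w -> (0 < i)%N -> (i <= j.+1)%N -> (j < n)%N ->
  (forall t, (i <= t <= j)%N -> w t) -> ~~ w j.+1 ->
  (exists k', reachable k' (hole i j w)) /\
  (\prod_(i <= r < j.+1) P r) *: vec w = vec (hole i j w).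
Proof.
move=> hw i0 ij jn wt wj; move ed : (j.+1 - i)%N => d; elim: d i i0 ij wt ed => [|d IH] i i0 ij wt ed.
  have -> : i = j.+1 by lia.
  have -> : hole j.+1 j w = w.
    apply/funext => t; rewrite /hole; case: ifP => // h; have -> : t = j.+1 by lia.
    by rewrite eqxx (negbTE wj).
  by split; [exists k | rewrite big_geq // scale1r].
have [|||[k' h'] e'] := IH i.+1 isT; [lia|by move=> t ht; apply: wt; lia|lia|].
have g1 : hole i.+1 j w i by rewrite /hole ifF; [apply: wt; lia|lia].
have g2 : ~~ hole i.+1 j w i.+1 by rewrite /hole ifT ?eqxx //; lia.
have [|h'' e''] := reachable_ascent e3 mn _ h' g1 g2; first by lia.
have es : sw i i.+1 (hole i.+1 j w) = hole i j w.
  have wi := wt i ltac:(lia).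
  apply/funext => t; rewrite /sw (negbTE g2) g1 /hole; case: (eqVneq t i) => [->|h1].
    by rewrite ifT //; lia.
  case: (eqVneq t i.+1) => [->|h2]; first by rewrite ifT //; lia.
  by have -> : (i < t <= j.+1)%N = (i <= t <= j.+1)%N by lia.
rewrite -es; split; first by exists k'.+1.
by rewrite -e'' -e' big_nat_recl; [|lia]; rewrite -[LHS]scalerA big_add1.
Qed.

End BihookModule.

Lemma nL_eq w w' k : (forall t, (t < k)%N -> w t = w' t) -> nL w k = nL w' k.
Proof.
by elim: k => //= k IH h; rewrite h // IH // => t ht; apply: h; lia.
Qed.

(** * The vectors defining the homomorphisms *)

Section PsiWords.
Variables (F : fieldType) (e n : nat).
Local Notation P := (klr_psi F e n).

Lemma psi_down_id a : psi_down F e n a a = 1.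
Proof. by rewrite /psi_down /index_iota subnn big_nil. Qed.

Lemma psi_down1 a : psi_down F e n a.+1 a = P a.
Proof. by rewrite /psi_down /index_iota subSnn /= big_seq1. Qed.

Lemma psi_word_rcons j s a :
  psi_word F e n j (rcons s a) = psi_word F e n j s * psi_down F e n a (j + size s).
Proof.
rewrite /psi_word size_rcons big_ord_recr /= nth_rcons ltnn eqxx; congr (_ * _).
by apply: eq_bigr => k _; rewrite nth_rcons ltn_ord.
Qed.

Lemma psi_word_iota j k : psi_word F e n j (iota j k) = 1.
Proof.
rewrite /psi_word big1 // => i _; rewrite nth_iota ?psi_down_id //.
by rewrite -[X in (_ < X)%N](size_iota j k).
Qed.

Lemma psi_word_shift k : psi_word F e n 1 (iota 2 k) = \prod_(1 <= r < k.+1) P r.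
Proof.
elim: k => [|k IH]; first by rewrite /psi_word big_ord0 big_geq.
have -> : iota 2 k.+1 = rcons (iota 2 k) k.+2 by rewrite -[k.+1]addn1 iotaD cats1 addn1.
by rewrite psi_word_rcons IH size_iota add1n psi_down1 [RHS]big_nat_recr.
Qed.

End PsiWords.

Section TargetVector.
Variables (F : fieldType) (e n : nat) (kappa1 kappa2 : 'Z_e) (m : nat).
Hypotheses (e3 : (3 <= e)%N) (mn : (m <= n)%N).
Variables (N : lmodType (klr F e n)) (x : N).
Hypothesis x_rel : forall a b, bihook_rel kappa1 kappa2 m a b -> a *: x = b *: x.
Local Notation E := (@klr_e F e n).
Local Notation Y := (klr_y F e n).
Local Notation P := (klr_psi F e n).
Local Notation sp := (special kappa1 kappa2).
Local Notation reachable := (reachable m x).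
Local Notation vec := (vec m x).

(** The charges of the source may differ from those of the module: in [chi_rel] a hook of charge
    [kappa] enters with charges [kappa + 1], [kappa]. *)
Lemma bihook_rel_vec (l1 l2 : 'Z_e) m' k w :
  reachable k w -> res_bihook n l1 l2 m' = resw n kappa1 kappa2 w ->
  (forall p, ~~ w p -> w p.+1 -> sp p = false) ->
  (forall r, (0 < r < n)%N -> r != m' -> act_psi sp r vec w = 0) ->
  forall a b, bihook_rel l1 l2 m' a b -> a *: vec w = b *: vec w.
Proof.
move=> hw hres hlow hpsi a b; case=> [|r hr|r hr rm].
- by rewrite scale1r hres (vec_weight e3 mn x_rel hw).
- have L p : act_low sp p vec w = 0.
    by rewrite /act_low; case: ifP => // /and3P[h1 h2 h3]; rewrite (hlow p) in h1.
  by rewrite scale0r (vec_y e3 mn x_rel hw hr) /act_y !L subr0.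
- by rewrite scale0r (vec_psi e3 mn x_rel hw hr) hpsi.
Qed.

End TargetVector.

(** This word and the next two belong to v(1,...,m,n), v(2,...,m+1) and v(2,...,m,n), with the
    padding leg letter at position 0. *)
Definition last_word n m : word := fun t => (t <= m)%N || (t == n).

Definition shift_word m : word := fun t => (t == 0)%N || (2 <= t <= m.+1)%N.

Definition shift_last_word n m : word := fun t => [|| t == 0, 2 <= t <= m | t == n]%N.

Section LastWord.
Variables (F : fieldType) (e n m : nat).
Hypotheses (e3 : (3 <= e)%N) (mn : (m < n)%N).
Variables (N : lmodType (klr F e n)) (x : N).
Local Notation vec := (vec m.+1 x).

Lemma last_word_reachable : (exists k, reachable m.+1 x k (last_word n m)) /\
  psi_down F e n n m.+1 *: x = vec (last_word n m).
Proof.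
have -> : last_word n m = sw m.+1 n (leg_word m.+1).
  apply/funext => t; rewrite /last_word /sw /leg_word.
  by do ![case: eqP => ?]; subst; lia.
rewrite -{2}(vec0 e3 mn x); apply: (move_down e3 mn (reachable0 _ _)); rewrite /leg_word //; lia.
Qed.

End LastWord.

Section Gamma.
Variables (F : fieldType) (e n : nat) (kappa1 kappa2 : 'Z_e) (m : nat).
Hypotheses (e3 : (3 <= e)%N) (mn : (m < n)%N).
Hypothesis n_res : n%:R = kappa2 - kappa1 + 1 :> 'Z_e.
Variables (N : lmodType (klr F e n)) (x : N).
Hypothesis x_rel : forall a b, bihook_rel kappa1 kappa2 m.+1 a b -> a *: x = b *: x.
Local Notation sp := (special kappa1 kappa2).
Local Notation vec := (vec m.+1 x).

(** The congruence makes [n] special, hence [n-1] and [n-2] are not. So turning the last arm letter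
    into a leg letter keeps its residue. An arm-leg pair can only end at [n]; the special position
    [n] forbids exchanging it, and neither [y] nor a jump can act there. *)
Lemma gamma_rel a b : bihook_rel kappa1 kappa2 m a b ->
  a *: vec (last_word n m) = b *: vec (last_word n m).
Proof.
have [[k hk] _] := last_word_reachable e3 mn x.
have sp_sparse : sparse sp by exact: sparse_special (two_neq0_Zp e3).
have spn : sp n by rewrite /special n_res; apply/eqP; ring.
have spn' p : (p.+1 == n) || (p.+2 == n) -> sp p = false.
  by move=> h; apply/negP => /sp_sparse[]; case/orP: h => /eqP ->; rewrite spn.
apply: (bihook_rel_vec e3 mn x_rel hk).
- rewrite resw_leg; apply: res_inj => r hr; rewrite !res_resw // /rs.
  rewrite (@nL_eq (last_word n m) (leg_word m)); last by move=> t ht; rewrite /last_word /leg_word; lia.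
  rewrite nL_leg /last_word /leg_word; case: (leqP r m) => h //=.
  case: eqP => // ->; rewrite (minn_idPr mn) n_res; ring.
- by move=> p; rewrite /last_word => h1 h2; apply: spn'; lia.
move=> r hr rm.
have J p : act_jump p vec (last_word n m) = 0 \/ p.+2 = n.
  rewrite /act_jump; case: ifP => [h|_]; last by left.
  by right; move: h; rewrite /last_word; lia.
rewrite /act_psi.
have -> : (if sp r.-1 then act_jump r.-1 vec (last_word n m) else 0) = 0.
  by case: ifP => // h; case: (J r.-1) => // h'; rewrite spn' ?h' ?eqxx ?orbT in h.
have -> : (if sp r.+1 then act_jump r vec (last_word n m) else 0) = 0.
  by case: ifP => // h; case: (J r) => // h'; rewrite spn' ?h' ?eqxx ?orbT in h.
rewrite ifF ?addr0 //; apply/negP => /andP[h1 h2].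
have e1 : r.+1 = n by move: h1; rewrite /last_word; lia.
by move: h2; rewrite e1 spn !orbT orbF; move: h1; rewrite /last_word; lia.
Qed.

End Gamma.

(** * Hook relations are bihook relations with a Garnir relation *)

Section HookRelations.
Variables (F : fieldType) (e n : nat) (kappa : 'Z_e) (m : nat).
Variables (N : lmodType (klr F e n)) (x : N).
Local Notation P := (klr_psi F e n).

(** The corner of the hook counts as the first leg letter, and the arm then starts with residue
    [kappa + 1]. *)
Lemma res_hook_bihook : res_hook n kappa m = res_bihook n (kappa + 1) kappa m.+1.
Proof.
apply: eq_from_tnth => k; rewrite !tnth_mktuple ltnS; case: leqP => // h.
have -> : (k - m = (k - m.+1).+1)%N by lia.
by rewrite -natr1; ring.
Qed.

Lemma hook_bihook :
  (forall a b, hook_rel kappa m a b -> a *: x = b *: x) ->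
  forall a b, bihook_rel (kappa + 1) kappa m.+1 a b -> a *: x = b *: x.
Proof.
move=> h a b [|r hr|r hr rm]; apply: h.
- by rewrite -res_hook_bihook; apply: hook_e.
- exact: hook_y.
- exact: hook_psi.
Qed.

Lemma bihook_hook :
  (forall a b, bihook_rel (kappa + 1) kappa m.+1 a b -> a *: x = b *: x) ->
  ((m.+2 <= n)%N -> (\prod_(1 <= r < m.+2) P r) *: x = 0) ->
  forall a b, hook_rel kappa m a b -> a *: x = b *: x.
Proof.
move=> h g a b [|r hr|r hr rm|hm]; last by rewrite scale0r g.
- by rewrite res_hook_bihook; apply: h; apply: bihook_e.
- by apply: h; apply: bihook_y.
- by apply: h; apply: bihook_psi.
Qed.

End HookRelations.

Section Chi.
Variables (F : fieldType) (e n : nat) (kappa : 'Z_e) (m : nat).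
Hypotheses (e3 : (3 <= e)%N) (mn : (m < n)%N).
Variables (N : lmodType (klr F e n)) (x : N).
Hypothesis x_rel : forall a b, bihook_rel kappa (kappa - 1) m a b -> a *: x = b *: x.
Local Notation P := (klr_psi F e n).
Local Notation sp := (special kappa (kappa - 1)).
Local Notation vec := (vec m x).
Let mn' : (m <= n)%N := ltnW mn.

Lemma shift_word_reachable : (exists k, reachable m x k (shift_word m)) /\
  (\prod_(1 <= r < m.+1) P r) *: x = vec (shift_word m).
Proof.
have -> : shift_word m = hole 1 m (leg_word m).
  apply/funext => t; rewrite /shift_word /hole /leg_word; case: ifP; lia.
rewrite -{2}(vec0 e3 mn' x); apply: (move_up e3 mn' (reachable0 _ _)); rewrite /leg_word; lia.
Qed.

Lemma nL_shift_word t : (0 < t)%N -> nL (shift_word m) t = (minn t.-1 m.+1 + (t == 1))%N.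
Proof.
elim: t => // t IH _; case: t IH => [|t] IH; first by rewrite /= /shift_word; lia.
by rewrite nL_succ IH // /shift_word; lia.
Qed.

(** Position 0 is special, so 1 and 2 are not. The arm letter of residue [kappa] at position 1 plays
    the corner of the hook; the pair it may form with a following leg letter cannot be exchanged
    back, because [psi_1] sees position 0. *)
Lemma chi_rel a b : hook_rel kappa m a b ->
  a *: vec (shift_word m) = b *: vec (shift_word m).
Proof.
have [[k hk] _] := shift_word_reachable.
have sp_sparse : sparse sp by exact: sparse_special (two_neq0_Zp e3).
have sp0 : sp 0 by rewrite /special; apply/eqP; ring.
have [sp1 sp2] : sp 1 = false /\ sp 2 = false.
  by have [/negbTE h1 /negbTE h2] := sp_sparse 0%N sp0.
have J p : act_jump p vec (shift_word m) = 0 \/ p = 1%N.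
  rewrite /act_jump; case: ifP => [h|_]; last by left.
  by right; move: h; rewrite /shift_word; lia.
apply: bihook_hook.
  apply: (bihook_rel_vec e3 mn' x_rel hk).
  - rewrite resw_leg; apply: res_inj => r hr; rewrite !res_resw // /rs.
    rewrite nL_leg nL_shift_word; last by lia.
    case: r hr => [|[|t]] hr //.
    rewrite minnSS /leg_word /shift_word /= addn0; case: ifP => _; rewrite -natr1; ring.
  - move=> p; rewrite /shift_word => h1 h2; have -> : p = 1%N by lia.
    exact: sp1.
  - move=> r hr rm; rewrite /act_psi.
    have -> : (if sp r.-1 then act_jump r.-1 vec (shift_word m) else 0) = 0.
      by case: ifP => // h; case: (J r.-1) => // h'; rewrite h' sp1 in h.
    have -> : (if sp r.+1 then act_jump r vec (shift_word m) else 0) = 0.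
      by case: ifP => // h; case: (J r) => // h'; rewrite h' sp2 in h.
    rewrite ifF ?addr0 //; apply/negP => /andP[h1 h2].
    have e1 : r = 1%N by move: h1; rewrite /shift_word; lia.
    by move: h2; rewrite e1 sp0 orbF /shift_word.
(* Garnir relation: all factors but [psi_1] bring the next arm letter to position 2. On two initial
   arm letters [psi_1] is zero, since 2 is not special and the padding leg letter blocks the jump at
   0. *)
move=> hm; rewrite big_ltn // -[LHS]scalerA.
have [|||||[k' h'] ->] := move_up (i := 2) (j := m.+1) e3 mn' hk; rewrite /shift_word //; [lia..|].
rewrite (vec_psi e3 mn' x_rel h'); last by lia.
rewrite /act_psi sp0 sp2 /act_jump /hole /shift_word /= addr0.
by rewrite /= ?addr0.
Qed.

End Chi.

Section HookModule.
Variables (F : fieldType) (e n : nat) (kappa : 'Z_e) (m : nat).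
Hypotheses (e3 : (3 <= e)%N) (mn : (m < n)%N).
Variables (N : lmodType (klr F e n)) (x : N).
Hypothesis x_rel : forall a b, hook_rel kappa m a b -> a *: x = b *: x.
Local Notation P := (klr_psi F e n).
Local Notation Y := (klr_y F e n).
Local Notation sp := (special (kappa + 1) kappa).
Local Notation reachable := (reachable m.+1 x).
Local Notation vec := (vec m.+1 x).
Let b_rel := hook_bihook x_rel.

(** Descents from position 2 on are peeled off without touching the first letter. A word with none
    left is an arm letter, then all [m + 1] leg letters, and its vector is the Garnir element
    applied to the generator. *)
Lemma hook_vec0 k w : reachable k w -> ~~ w 1%N -> vec w = 0.
Proof.
elim: k w => [|k IH] w hw w1.
  by case: (reachable_case hw) => [[_ ew]|[s [ws ws1]]];
    [move: w1; rewrite ew | have [k' []] := reachable_descent e3 mn hw ws ws1].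
case: (pselect (exists s, [/\ (2 <= s)%N, ~~ w s & w s.+1])) => [[s [s2 ws ws1]]|no].
  have [k' [[<-] h' _ ->]] := reachable_descent e3 mn hw ws ws1.
  by rewrite IH ?scaler0 // sw_out //; lia.
have mon s t : (2 <= s)%N -> ~~ w s -> ~~ w (s + t)%N.
  move=> s2 ws; elim: t => [|t IHt]; first by rewrite addn0.
  apply/negP; rewrite addnS => wt; apply: no.
  by exists (s + t)%N; split=> //; lia.
have w0 := reachable_head e3 mn hw.
(* [c] is the first arm position from 2 on; counting leg letters forces it to be [m + 3]. *)
have [c hc] : exists c, forall t, (2 <= t)%N -> w t = (t < c)%N.
  have ex : exists c, (2 <= c)%N && ~~ w c.
    by exists n.+2; rewrite (reachable_tail e3 mn hw) //; lia.
  exists (ex_minn ex); case: ex_minnP => c /andP[c2 wc] hmin t t2.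
  case: ltnP => h; last by apply/negbTE; rewrite -(subnKC h); apply: mon.
  by apply: contraLR h => wt; rewrite -leqNgt hmin // t2.
have cnt t : (2 <= t)%N -> nL w t = (minn t (maxn c 2)).-1.
  case: t => [|[|t]] // _; elim: t => [|t IHt].
    by rewrite /= w0 (negbTE w1); lia.
  by rewrite nL_succ (hc t.+2) // IHt; lia.
have := reachable_count e3 mn hw; rewrite cnt; last by lia.
have cn : (c <= n.+1)%N.
  by have := hc n.+1; rewrite (reachable_tail e3 mn hw) // => /(_ ltac:(lia)); lia.
move=> hcnt; have [hc1 hmn] : c = m.+3 /\ (m.+2 <= n)%N by lia.
have -> : w = hole 1 m.+1 (leg_word m.+1).
  apply/funext => -[|[|t]]; rewrite /hole /leg_word.
  - by rewrite w0.
  - by rewrite (negbTE w1).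
  - by rewrite hc // hc1; case: ifP; lia.
have [|||||_ <-] := move_up (i := 1) (j := m.+1) e3 mn (reachable0 _ x); rewrite /leg_word //; [lia..|].
by rewrite (vec0 e3 mn) (x_rel (hook_garnir _ _ hmn)) scale0r.
Qed.

Lemma hook_cyc (l1 l2 : 'Z_e) : kappa = l1 \/ kappa = l2 ->
  (forall u : N, exists a, u = a *: x) ->
  satisfies (@cyc_rel F e n l1 l2) N.
Proof.
move=> hl gen a b [i] u; rewrite scale0r; move: u; apply: (span_kill e3 mn b_rel) => // k w hw.
have n0 : (0 < n)%N by lia.
rewrite -[LHS]scalerA -(vec_weight e3 mn b_rel hw) klr_eeE.
case: eqP => [->|_]; last by rewrite scaler0.
rewrite (vec_weight e3 mn b_rel hw) /cyc_mult (res_head (kappa + 1) kappa e3 mn n0 hw).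
case w1: (w 1%N); last by rewrite (hook_vec0 hw) ?w1 // scaler0.
apply: expr_scale.
  rewrite (vec_y1 e3 mn b_rel n0 hw) /act_low ifF ?oppr0 //.
  by rewrite w1 andbF.
by case: hl => ->; rewrite eqxx ?addn1 ?add1n; lia.
Qed.

End HookModule.

(** * Non-vanishing in the module of words *)

Section Nonzero.
Variables (F : fieldType) (e n : nat) (kappa1 kappa2 : 'Z_e) (m : nat).
Hypotheses (e3 : (3 <= e)%N) (mn : (m <= n)%N).
Local Notation z := (z_bihook F n kappa1 kappa2 m).
Local Notation focks := (@fock_satisfies F e n kappa1 kappa2 e3).
Local Notation ketw := (ket F n kappa1 kappa2 : word -> descend focks).

Lemma ket_neq0 w : ket F n kappa1 kappa2 w != 0.
Proof. by rewrite monalgU_eq0 oner_eq0. Qed.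

Lemma fock_rel a b : bihook_rel kappa1 kappa2 m a b ->
  a *: ketw (leg_word m) = b *: ketw (leg_word m).
Proof.
have S c w : quot_pi (@klr_rel F e n) c *: ketw w = c *: ket F n kappa1 kappa2 w.
  exact: descend_scaleE.
have [L J] : (forall p, act_low (special kappa1 kappa2) p (ket F n kappa1 kappa2) (leg_word m) = 0)
  /\ (forall p, act_jump p (ket F n kappa1 kappa2) (leg_word m) = 0).
  by split=> p; rewrite /act_low /act_jump /leg_word ifF //; lia.
case=> [|r hr|r hr rm].
- by rewrite scale1r S free_e_ket /act_e resw_leg eqxx.
- by rewrite scale0r S free_y_ket // /act_y !L subr0.
- rewrite scale0r S free_psi_ket // /act_psi !J !if_same ifF ?addr0 //.
  by rewrite /leg_word; lia.
Qed.

(** The word of the generator satisfies the bihook relations, so the presented module maps to the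
    module of words, and this map sends [vec w] to the basis element [ket w]. *)
Lemma vec_neq0 k w : reachable m z k w -> vec m z w != 0.
Proof.
case=> u hu; rewrite (reach_vec e3 mn hu).
have [f fz] := pres_hom fock_rel.
suff h : f u = ketw w.
  by apply: contra_neq (ket_neq0 w) => u0; rewrite -[LHS]h u0 linear0.
elim: hu => [|{}k {}w {}u r hr _ IH wr wr1]; first exact: fz.
rewrite linearZ /= IH.
have -> : klr_psi F e n r *: ketw w = free_psi F e n r *: ket F n kappa1 kappa2 w.
  exact: descend_scaleE.
by rewrite free_psi_ket // (act_psi_ascent _ _ wr wr1).
Qed.

End Nonzero.

Lemma linear_scale_eq (A : pzRingType) (M N : lmodType A) (f : {linear M -> N}) a b u :
  a *: u = b *: u -> a *: f u = b *: f u.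
Proof. by move=> ab; rewrite -!linearZ ab. Qed.

Lemma pres_nonzero_cyc_hom (F : fieldType) (e n : nat) (kappa1 kappa2 : 'Z_e)
    (X : klr F e n -> klr F e n -> Prop) (N : lmodType (klr F e n)) (w : N) :
  (forall a b, X a b -> a *: w = b *: w) ->
  satisfies (@cyc_rel F e n kappa1 kappa2) (pres_mod X) ->
  satisfies (@cyc_rel F e n kappa1 kappa2) N -> w != 0 ->
  nonzero_cyc_hom kappa1 kappa2 (pres_gen X) w.
Proof.
move=> hw hM hN w0; have [f fz] := pres_hom hw.
by rewrite -fz; apply: nonzero_cyc_homP => //; rewrite fz.
Qed.

(** * Specht modules *)

Section SpechtModules.
Variables (F : fieldType) (e n : nat).
Hypotheses (e3 : (3 <= e)%N) (n0 : (0 < n)%N).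
Local Notation P := (klr_psi F e n).

Lemma z_bihook_rel (k1 k2 : 'Z_e) m a b :
  bihook_rel k1 k2 m a b -> a *: z_bihook F n k1 k2 m = b *: z_bihook F n k1 k2 m.
Proof. exact: pres_gen_rel. Qed.

Lemma z_hook_rel (kappa : 'Z_e) m a b :
  hook_rel kappa m a b -> a *: z_hook F n kappa m = b *: z_hook F n kappa m.
Proof. exact: pres_gen_rel. Qed.

Lemma specht_bihook_cyc (k1 k2 : 'Z_e) m : (m <= n)%N ->
  satisfies (@cyc_rel F e n k1 k2) (specht_bihook F n k1 k2 m).
Proof.
move=> mn; apply: (bihook_cyc e3 mn (@z_bihook_rel k1 k2 m)) => //.
exact: pres_gen_span.
Qed.

Lemma specht_hook_cyc (kappa k1 k2 : 'Z_e) m : (m < n)%N -> kappa = k1 \/ kappa = k2 ->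
  satisfies (@cyc_rel F e n k1 k2) (specht_hook F n kappa m).
Proof.
move=> mn hk; apply: (hook_cyc e3 mn (@z_hook_rel kappa m)) => //.
exact: pres_gen_span.
Qed.

Lemma v_bihook_last (k1 k2 : 'Z_e) m : (m < n)%N ->
  v_bihook F n k1 k2 m.+1 (rcons (iota 1 m) n) = vec m.+1 (z_bihook F n k1 k2 m.+1) (last_word n m).
Proof.
move=> mn; have [_ <-] := last_word_reachable e3 mn (z_bihook F n k1 k2 m.+1).
by rewrite /v_bihook psi_word_rcons psi_word_iota mul1r size_iota.
Qed.

Lemma v_bihook_shift (k1 k2 : 'Z_e) m : (m < n)%N ->
  v_bihook F n k1 k2 m (iota 2 m) = vec m (z_bihook F n k1 k2 m) (shift_word m).
Proof.
move=> mn; have [_ <-] := shift_word_reachable e3 mn (z_bihook F n k1 k2 m).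
by rewrite /v_bihook psi_word_shift.
Qed.

Lemma v_hook_last (kappa : 'Z_e) m : (m.+1 < n)%N ->
  v_hook F n kappa m.+1 (rcons (iota 2 m) n) = vec m.+2 (z_hook F n kappa m.+1) (last_word n m.+1).
Proof.
move=> mn; have [_ <-] := last_word_reachable e3 mn (z_hook F n kappa m.+1).
by rewrite /v_hook psi_word_rcons psi_word_iota mul1r size_iota.
Qed.

(** The last leg letter is sent to [n] either after or before an arm letter is brought to the front;
    both orders reach the same word. Hence a map of type [chi] sends the hook vector v(2,...,m+1,n)
    to the bihook vector of the same name. *)
Lemma shift_last (N : lmodType (klr F e n)) (x : N) m : (m.+1 < n)%N ->
  [/\ exists k, reachable m.+1 x k (shift_last_word n m.+1),
      psi_word F e n 2 (rcons (iota 2 m) n) *: vec m.+1 x (shift_word m.+1) =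
        vec m.+1 x (shift_last_word n m.+1)
    & psi_word F e n 1 (rcons (iota 2 m) n) *: x = vec m.+1 x (shift_last_word n m.+1)].
Proof.
move=> mn; have mn' := ltnW mn.
have [[k hk] _] := shift_word_reachable e3 mn x.
have [[k' hk'] e'] := last_word_reachable e3 mn' x.
have e1 : sw m.+2 n (shift_word m.+1) = shift_last_word n m.+1.
  apply/funext => t; rewrite /shift_word /shift_last_word /sw.
  by do ![case: eqP => ?]; subst; lia.
have e2 : hole 1 m (last_word n m) = shift_last_word n m.+1.
  apply/funext => t; rewrite /hole /last_word /shift_last_word; case: ifP; lia.
have [||||h1 h2] := move_down (j := m.+2) (a := n) e3 mn' hk; rewrite /shift_word //; [lia..|].
have [|||||h3 h4] := move_up (i := 1) (j := m) e3 mn' hk'; rewrite /last_word //; [lia..|].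
split.
- by rewrite -e1.
- by rewrite psi_word_rcons psi_word_iota mul1r size_iota -e1 -h2.
- by rewrite psi_word_rcons psi_word_shift size_iota -[LHS]scalerA e' -e2 -h4.
Qed.

Lemma chi_map (kappa : 'Z_e) m : (m < n)%N ->
  exists f : {linear specht_hook F n kappa m -> specht_bihook F n kappa (kappa - 1) m},
    f (z_hook F n kappa m) = v_bihook F n kappa (kappa - 1) m (iota 2 m).
Proof.
move=> mn; rewrite v_bihook_shift //; apply: pres_hom.
exact: (chi_rel e3 mn (@z_bihook_rel kappa (kappa - 1) m)).
Qed.

Lemma v_bihook_shift_neq0 (k1 k2 : 'Z_e) m : (m < n)%N ->
  v_bihook F n k1 k2 m (iota 2 m) != 0.
Proof.
move=> mn; rewrite v_bihook_shift //.
have [[k hk] _] := shift_word_reachable e3 mn (z_bihook F n k1 k2 m).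
exact: (vec_neq0 e3 (ltnW mn) hk).
Qed.

Lemma z_hook_neq0 (kappa : 'Z_e) m : (m < n)%N -> z_hook F n kappa m != 0.
Proof.
move=> mn; have [f fz] := chi_map kappa mn.
by apply: contra_neq (v_bihook_shift_neq0 kappa (kappa - 1) mn) => z0; rewrite -fz z0 linear0.
Qed.

Lemma chi_v_hook (kappa : 'Z_e) m : (m.+1 < n)%N ->
  exists f : {linear specht_hook F n kappa m.+1 -> specht_bihook F n kappa (kappa - 1) m.+1},
    f (v_hook F n kappa m.+1 (rcons (iota 2 m) n)) =
      v_bihook F n kappa (kappa - 1) m.+1 (rcons (iota 2 m) n) /\
    v_bihook F n kappa (kappa - 1) m.+1 (rcons (iota 2 m) n) != 0.
Proof.
move=> mn; have [f fz] := chi_map kappa mn; exists f.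
have [[k hk] h1 h2] := shift_last (z_bihook F n kappa (kappa - 1) m.+1) mn.
split; last by rewrite /v_bihook h2; apply: (vec_neq0 e3 (ltnW mn) hk).
have -> : f (v_hook F n kappa m.+1 (rcons (iota 2 m) n)) =
    psi_word F e n 2 (rcons (iota 2 m) n) *: f (z_hook F n kappa m.+1) by exact: linearZ.
have e1 : f (z_hook F n kappa m.+1) =
    vec m.+1 (z_bihook F n kappa (kappa - 1) m.+1) (shift_word m.+1).
  by rewrite fz v_bihook_shift // ltnW.
by rewrite [X in _ *: X = _]e1; apply: etrans h1 (esym h2).
Qed.

(** For charges [kappa + 1], [kappa] the congruence of [gamma_rel] reads [n = 0]. The Garnir product
    brings an arm letter to the front, giving zero; if [n = m + 2] no arm letter is left, the vector
    is the generator, and [psi_(m+1)] kills it. *)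
Lemma alpha_rel (kappa : 'Z_e) m a b : (m.+1 < n)%N -> n%:R = 0 :> 'Z_e ->
  hook_rel kappa m a b ->
  a *: vec m.+2 (z_hook F n kappa m.+1) (last_word n m.+1) =
  b *: vec m.+2 (z_hook F n kappa m.+1) (last_word n m.+1).
Proof.
move=> mn hn; set x := z_hook F n kappa m.+1.
have x_rel := @z_hook_rel kappa m.+1.
have b_rel := hook_bihook x_rel.
have hn' : n%:R = kappa - (kappa + 1) + 1 :> 'Z_e by rewrite hn; ring.
move: a b; apply: bihook_hook; first exact: (gamma_rel e3 mn hn' b_rel).
move=> _; have [[k hk] _] := last_word_reachable e3 mn x.
case: (ltnP m.+2 n) => mn2.
  have [|||||[k' h'] ->] := move_up (i := 1) (j := m.+1) e3 mn hk; rewrite /last_word //; [lia..|].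
  by apply: (hook_vec0 e3 mn x_rel h').
have en : n = m.+2 by lia.
have -> : last_word n m.+1 = leg_word m.+2.
  by apply/funext => t; rewrite /last_word /leg_word en; lia.
rewrite (vec0 e3 mn) big_nat_recr //= -[LHS]scalerA.
have hr : (0 < m.+1 < n)%N by lia.
by rewrite (b_rel _ _ (bihook_psi _ _ _ hr _)) ?scale0r ?scaler0 //; lia.
Qed.

End SpechtModules.

Theorem proposition5p6 (F : fieldType) (e n : nat) (kappa1 kappa2 : 'Z_e) :
  (3 <= e)%N -> (1 <= n)%N ->
  (n%:R = kappa2 - kappa1 + 1 :> 'Z_e ->
     forall m : nat, (m <= n - 1)%N ->
       nonzero_cyc_hom kappa1 kappa2
         (z_bihook F n kappa1 kappa2 m)
         (v_bihook F n kappa1 kappa2 m.+1 (rcons (iota 1 m) n)))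
  /\
  (kappa2 = kappa1 - 1 ->
     (forall m : nat, (1 <= m <= n - 1)%N ->
       nonzero_cyc_hom kappa1 kappa2
         (z_hook F n kappa1 m)
         (v_bihook F n kappa1 kappa2 m (iota 2 m)))
     /\
     (forall m : nat, (1 <= m <= n)%N ->
       nonzero_cyc_hom kappa1 kappa2
         (z_bihook F n kappa1 kappa2 m)
         (z_hook F n kappa2 (m - 1))))
  /\
  (kappa2 = kappa1 - 1 -> n%:R = 0 :> 'Z_e ->
     [/\ forall m : nat, (m + 2 <= n)%N ->
           nonzero_cyc_hom kappa1 kappa2
             (z_hook F n kappa1 m)
             (v_hook F n kappa1 m.+1 (rcons (iota 2 m) n)),
         forall m : nat, (m + 2 <= n)%N ->
           nonzero_cyc_hom kappa1 kappa2
             (z_hook F n kappa2 m)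
             (v_hook F n kappa2 m.+1 (rcons (iota 2 m) n))
       & forall m : nat, (1 <= m <= n - 1)%N ->
           nonzero_cyc_hom kappa1 kappa2
             (z_hook F n kappa1 (m - 1))
             (v_bihook F n kappa1 kappa2 m (rcons (iota 2 (m - 1)) n))]).
Proof.
move=> e3 n0.
have alpha kappa m : kappa = kappa1 \/ kappa = kappa2 -> n%:R = 0 :> 'Z_e ->
    (m + 2 <= n)%N -> nonzero_cyc_hom kappa1 kappa2 (z_hook F n kappa m)
      (v_hook F n kappa m.+1 (rcons (iota 2 m) n)).
  move=> hk hn mn; have mn2 : (m.+1 < n)%N by lia.
  have [f [fv v0]] := chi_v_hook F e3 n0 kappa mn2.
  rewrite v_hook_last // in fv *; apply: pres_nonzero_cyc_hom.
  - by move=> a b; apply: alpha_rel.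
  - by apply: specht_hook_cyc => //; lia.
  - exact: specht_hook_cyc.
  - by apply: contra_neq v0 => h; rewrite -fv h linear0.
split=> [hn m hm|].
  have mn : (m < n)%N by lia.
  rewrite v_bihook_last //; apply: pres_nonzero_cyc_hom.
  - exact: (gamma_rel e3 mn hn (@z_bihook_rel F e n kappa1 kappa2 m.+1)).
  - by apply: specht_bihook_cyc => //; lia.
  - exact: specht_bihook_cyc.
  - have [[k hk] _] := last_word_reachable e3 mn (z_bihook F n kappa1 kappa2 m.+1).
    exact: (vec_neq0 e3 mn hk).
split=> ek; last split=> // [m hm|m hm|m hm].
- split=> m hm.
    have mn : (m < n)%N by lia.
    have v0 := v_bihook_shift_neq0 F e3 kappa1 (kappa1 - 1) mn.
    have ev := v_bihook_shift F e3 kappa1 (kappa1 - 1) mn.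
    rewrite ev in v0; rewrite ek ev; apply: pres_nonzero_cyc_hom v0.
    + exact: (chi_rel e3 mn (@z_bihook_rel F e n kappa1 (kappa1 - 1) m)).
    + by apply: specht_hook_cyc => //; left.
    + by apply: specht_bihook_cyc => //; lia.
  have mn : (m - 1 < n)%N by lia.
  apply: pres_nonzero_cyc_hom.
  (* For [tau_m] the source relations are among those of the hook, read with charges [kappa2 + 1],
     [kappa2]. *)
  + have -> : kappa1 = kappa2 + 1 by rewrite ek subrK.
    have {1}-> : m = (m - 1).+1 by lia.
    exact: (hook_bihook (@z_hook_rel F e n kappa2 (m - 1))).
  + by apply: specht_bihook_cyc => //; lia.
  + by apply: specht_hook_cyc => //; right.
  + exact: z_hook_neq0.
- by apply: alpha => //; left.
- by apply: alpha => //; right.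
- have [m' em] : exists m', m = m'.+1 by exists m.-1; lia.
  subst m; rewrite subn1 /=; have mn : (m'.+1 < n)%N by lia.
  (* [phi_m] is the composite of [alpha_(m-1)] and [chi_m]: its image vector is [chi_m] of the image
     vector of [alpha_(m-1)], so it inherits the relations. *)
  rewrite ek; have [f [fv v0]] := chi_v_hook F e3 n0 kappa1 mn.
  rewrite -fv in v0 *; apply: pres_nonzero_cyc_hom v0.
  + rewrite (v_hook_last F e3 kappa1 mn) => a b hab.
    by apply: linear_scale_eq; apply: alpha_rel hab.
  + by apply: specht_hook_cyc => //; [lia|left].
  + by apply: specht_bihook_cyc => //; lia.
Qed.
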